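(* (Path Murnaghan--Nakayama rule.) Let $\mu\vdash n$. Then \[ \vec{p}_{\mu} \;=\; m(\mu)!\cdot \sum_T \mathrm{sign}(T)\, s_{\mathrm{shape}(T)}, \] where the sum is over all monotonic ribbon tilings $T$ with $\mathrm{sort}(\mathrm{type}(T))=\mu$, and $s_\lambda$ denotes the Schur function.
   Context: For a partition $\mu$, $m_i(\mu)$ is the multiplicity of $i$ as a part of $\mu$ and $m(\mu)!:=\prod_{i\ge1} m_i(\mu)!$. Partial permutations: for $0\le k\le n$, a partial permutation of $[n]$ of size $k$ is a pair $(I,J)$ with $I=(i_1,\dots,i_k)$, $J=(j_1,\dots,j_k)$ sequences of distinct elements of $[n]$. For $w\in\mathfrak S_n$, $w(I)=J$ means $w(i_p)=j_p$ for all $p$. The indicator $\mathbf 1_{I,J}:\mathfrak S_n\to\mathbb C$ is $1$ at $w$ if $w(I)=J$ and $0$ otherwise. The graph $G(I,J)$ is the directed graph on vertex set $[n]$ with edges $i_p\to j_p$ ($1\le p\le k$); its components are directed paths (including isolated vertices) and directed cycles. The Reynolds operator is $(Rf)(w)=\frac1{n!}\sum_{v\in\mathfrak S_n}f(v^{-1}wv)$; the Frobenius characteristic of a class function $f$ is $\mathrm{ch}_n(f)=\frac1{n!}\sum_{w\in\mathfrak S_n}f(w)p_{\mathrm{cyc}(w)}$, where $\mathrm{cyc}(w)$ is the cycle type of $w$ and $p_\lambda$ the power sum symmetric function. The atomic symmetric function is $A_{n,I,J}:=n!\cdot\mathrm{ch}_n(R\,\mathbf 1_{I,J})$. For a partition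 $\mu=(\mu_1,\dots,\mu_k)$ of $n$, the path power sum $\vec p_\mu$ is $A_{n,I,J}$ for any partial permutation $(I,J)$ of $[n]$ whose graph $G(I,J)$ is a disjoint union of directed paths with $\mu_1,\dots,\mu_k$ vertices (this does not depend on the choice of $(I,J)$). Ribbons: a ribbon is an edgewise connected skew diagram containing no $2\times2$ square; its height $\mathrm{ht}(\xi)$ is the number of rows it occupies minus one, $\mathrm{sign}(\xi)=(-1)^{\mathrm{ht}(\xi)}$, and its tail is its southwesternmost cell (English notation, rows numbered top to bottom). A monotonic ribbon tiling $T$ of a partition $\lambda$ is a decomposition $\lambda=\xi^{(1)}\sqcup\cdots\sqcup\xi^{(r)}$ of the Young diagram of $\lambda$ into ribbons such that the tails of $\xi^{(1)},\dots,\xi^{(r)}$ lie in distinct columns $c_1<\cdots<c_r$, and each union $\xi^{(1)}\sqcup\cdots\sqcup\xi^{(i)}$ ($0\le i\le r$) is the Young diagram of a partition. Its shape is $\mathrm{shape}(T)=\lambda$, its sign is $\mathrm{sign}(T)=\prod_i\mathrm{sign}(\xi^{(i)})$, its type is the composition $\mathrm{type}(T)=(|\xi^{(1)}|,\dots,|\xi^{(r)}|)$, and $\mathrm{sort}(\mathrm{type}(T))$ is the partition obtained by sorting the type into weakly decreasing order. *)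

(* Defs.v *)
From mathcomp Require Import all_boot all_order all_algebra all_fingroup.
From mathcomp Require Import mpoly.

Set Implicit Arguments.
Unset Strict Implicit.
Unset Printing Implicit Defensive.

Import GRing.Theory.
Local Open Scope ring_scope.

(* Conventions.
   - [n] is 'I_n, and cells are numbered from 0.
   - The ring of symmetric functions is the (graded) inverse limit of the rings
     of symmetric polynomials in N variables: a symmetric function F is given
     by its images F(x_0, ..., x_(N-1)), and two symmetric functions are equal
     iff these images are equal for every N.  Every symmetric function below
     takes the number N of variables as a parameter. *)

Definition is_part (la : seq nat) : bool := sorted geq la && (0%N \notin la).

Definition is_part_of (n : nat) (la : seq nat) : bool :=
  is_part la && (sumn la == n).

(* The parts of mu do not exceed sumn mu, so the other factors are 0! = 1. *)
Definition mult_fact (mu : seq nat) : nat :=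
  (\prod_(1 <= i < (sumn mu).+1) (count_mem i mu)`!)%N.

(* Cells (row, column), in English notation.  A Young diagram with at most n
   cells fits in the n x n box, whose cells form a finite type. *)
Notation cell n := ('I_n * 'I_n)%type.

Section Diagrams.
Variable n : nat.
Implicit Types (D L M : {set cell n}) (c d : cell n) (la : seq nat).

Definition young la : {set cell n} :=
  [set c : cell n | (c.2 < nth 0 la c.1)%N].

Definition row_lengths D : seq nat :=
  [seq #|[set j : 'I_n | (i, j) \in D]| | i <- enum 'I_n].

Definition shape_of D : seq nat := [seq l <- row_lengths D | l != 0%N].

Definition is_young D : bool :=
  is_part (shape_of D) && (D == young (shape_of D)).

Definition is_skew D : bool :=
  [exists L : {set cell n}, exists M : {set cell n},
     [&& is_young L, is_young M, M \subset L & D == L :\: M]].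

Definition adjacent : rel (cell n) := fun c d =>
     (c.1 == d.1) && ((d.2 == c.2.+1 :> nat) || (c.2 == d.2.+1 :> nat))
  || (c.2 == d.2) && ((d.1 == c.1.+1 :> nat) || (c.1 == d.1.+1 :> nat)).

Definition edge_connected D : bool :=
  [forall c in D, forall d in D,
     connect [rel x y | [&& x \in D, y \in D & adjacent x y]] c d].

Definition has_square D : bool :=
  [exists c in D, exists d in D,
     [&& d.1 == c.1.+1 :> nat, d.2 == c.2.+1 :> nat,
         (c.1, d.2) \in D & (d.1, c.2) \in D]].

Definition is_ribbon D : bool :=
  [&& D != set0, is_skew D, edge_connected D & ~~ has_square D].

Definition height D : nat := #|[set c.1 | c in D]|.-1.

(* The default is not used for a ribbon, which always has a southwesternmost
   cell. *)
Definition tail_column D : nat :=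
  if [pick c in D | [forall d in D, (d.1 <= c.1)%N && (c.2 <= d.2)%N]] is Some c
  then c.2 else 0%N.

(* A tiling is listed as xi^(1), ..., xi^(r); the order is determined by the
   columns of the tails, so each tiling is listed exactly once. *)
Implicit Type T : seq {set cell n}.

Definition tile_union T : {set cell n} := \bigcup_(xi <- T) xi.

Definition is_mono_ribbon_tiling T : bool :=
  [&& all is_ribbon T,
      pairwise (fun xi zeta : {set cell n} => [disjoint xi & zeta]) T,
      sorted ltn [seq tail_column xi | xi <- T]
    & all (fun i => is_young (tile_union (take i T))) (iota 0 (size T).+1)].

Definition tiling_shape T : seq nat := shape_of (tile_union T).

Definition tiling_type T : seq nat := [seq #|xi| | xi : {set cell n} <- T].

Definition tiling_sign (R : pzRingType) T : R :=
  \prod_(xi <- T) (-1) ^+ height xi.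

End Diagrams.

Arguments tiling_sign {n} R T.

Section SymmetricFunctions.
Variables (R : comNzRingType) (N : nat).

Definition psum (la : seq nat) : {mpoly R[N]} :=
  \prod_(k <- la) \sum_(i < N) 'X_i ^+ k.

Definition cell_of (la : seq nat) : finType :=
  {c : cell (sumn la) | c \in young (sumn la) la}.

Definition is_ssyt (la : seq nat) (t : {ffun cell_of la -> 'I_N}) : bool :=
  [forall c : cell_of la, forall d : cell_of la,
     (((val c).1 == (val d).1) && ((val c).2 < (val d).2)%N ==> (t c <= t d)%N)
  && (((val c).2 == (val d).2) && ((val c).1 < (val d).1)%N ==> (t c < t d)%N)].

Definition schur (la : seq nat) : {mpoly R[N]} :=
  \sum_(t : {ffun cell_of la -> 'I_N} | is_ssyt t) \prod_c 'X_(t c).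

End SymmetricFunctions.

Section Atomic.
Variables (C : fieldType) (n : nat).
Implicit Types (I J : seq 'I_n) (f : 'S_n -> C).

Definition is_partial_perm I J : bool :=
  [&& size I == size J, uniq I & uniq J].

Definition pp_indicator I J : 'S_n -> C :=
  fun w => ([seq w i | i <- I] == J)%:R.

(* The product of permutations applies its left factor first, so that
   v * w * v^-1 is the map v^-1 o w o v. *)
Definition reynolds f : 'S_n -> C :=
  fun w => (n`!%:R)^-1 * \sum_(v : 'S_n) f (v * w * v^-1)%g.

Definition cycle_type (w : 'S_n) : seq nat :=
  sort geq [seq #|X| | X : {set 'I_n} in porbits w].

Definition frobenius_ch (N : nat) f : {mpoly C[N]} :=
  (n`!%:R)^-1 *: \sum_(w : 'S_n) f w *: psum C N (cycle_type w).

Definition atomic (N : nat) I J : {mpoly C[N]} :=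
  n`!%:R *: frobenius_ch N (reynolds (pp_indicator I J)).

Definition pp_edge I J : rel 'I_n := fun x y => (x, y) \in zip I J.

(* A path is the list of its vertices; these are the edges of a list of
   paths. *)
Definition path_edges (T : Type) (ps : seq (seq T)) : seq (T * T) :=
  flatten [seq zip p (behead p) | p <- ps].

(* The graph of (I, J) is a disjoint union of directed paths with
   mu_1, ..., mu_k vertices. *)
Definition is_path_graph (mu : seq nat) I J : Prop :=
  exists ps : seq (seq 'I_n),
    [/\ [seq size p | p <- ps] = mu,
        perm_eq (flatten ps) (enum 'I_n)
      & forall x y, pp_edge I J x y = ((x, y) \in path_edges ps)].

(* The path power sum, for the partial permutation whose graph consists of
   paths on consecutive intervals of [n] of lengths mu_1, ..., mu_k.  The two
   lemmas path_psum_graph and path_psumE show that this partial permutation is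
   of the required kind, and that any other choice gives the same result. *)
Definition path_psum (N : nat) (mu : seq nat) : {mpoly C[N]} :=
  let E := path_edges (reshape mu (enum 'I_n)) in
  atomic N (unzip1 E) (unzip2 E).

Lemma uniq_flatten_sub (T : eqType) (h : seq T -> seq T) (ps : seq (seq T)) :
  (forall p, subseq (h p) p) ->
  uniq (flatten ps) -> uniq (flatten [seq h p | p <- ps]).
Proof.
move=> hs; apply: subseq_uniq; elim: ps => //= p ps IH.
exact: cat_subseq.
Qed.

Lemma unzip1_path_edges (T : Type) (ps : seq (seq T)) :
  unzip1 (path_edges ps) = flatten [seq take (size p).-1 p | p <- ps].
Proof.
rewrite /path_edges /unzip1 map_flatten -map_comp; congr flatten.
apply: eq_map => -[|x p] //=; elim: p x => //= y p IH x.
by rewrite IH.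
Qed.

Lemma unzip2_path_edges (T : Type) (ps : seq (seq T)) :
  unzip2 (path_edges ps) = flatten [seq behead p | p <- ps].
Proof.
rewrite /path_edges /unzip2 map_flatten -map_comp; congr flatten.
by apply: eq_map => p /=; apply: unzip2_zip; rewrite size_behead leq_pred.
Qed.

Lemma path_psum_graph (mu : seq nat) :
  is_part_of n mu ->
  let E := path_edges (reshape mu (enum 'I_n)) in
  is_partial_perm (unzip1 E) (unzip2 E)
  /\ is_path_graph mu (unzip1 E) (unzip2 E).
Proof.
case/andP=> _ /eqP smu E.
have fE : flatten (reshape mu (enum 'I_n)) = enum 'I_n.
  by apply: reshapeKr; rewrite size_enum_ord smu.
split.
  rewrite /is_partial_perm !size_map eqxx unzip1_path_edges unzip2_path_edges /=.
  apply/andP; split.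
    apply: (@uniq_flatten_sub _ (fun p => take (size p).-1 p)) => [p|].
      exact: take_subseq.
    by rewrite fE enum_uniq.
  apply: (@uniq_flatten_sub _ behead) => [p|]; last by rewrite fE enum_uniq.
  by rewrite -drop1 drop_subseq.
exists (reshape mu (enum 'I_n)); split.
- by apply: reshapeKl; rewrite size_enum_ord smu.
- by rewrite fE.
by move=> x y; rewrite /pp_edge zip_unzip.
Qed.

Lemma path_edges_map (T S : Type) (g : T -> S) (ps : seq (seq T)) :
  path_edges [seq [seq g x | x <- p] | p <- ps]
    = [seq (g e.1, g e.2) | e <- path_edges ps].
Proof.
rewrite /path_edges map_flatten -!map_comp; congr flatten.
apply: eq_map => -[|x p] //=.
by elim: p x => //= y p IH x; rewrite IH.
Qed.

Lemma pp_imageP (w : 'I_n -> 'I_n) I J : size I = size J ->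
  reflect (forall x y, pp_edge I J x y -> w x = y) (map w I == J).
Proof.
rewrite /pp_edge => sIJ; apply: (iffP eqP) => [<- x y|].
  by elim: I {sIJ} => //= i I IH; rewrite inE => /orP[/eqP[-> ->]|/IH].
elim: I J sIJ => [|i I IH] [|j J] //= [sIJ] H.
rewrite (H i j) ?mem_head // (IH J) // => x y xy.
by apply: H; rewrite inE xy orbT.
Qed.

Lemma path_graph_conj (mu : seq nat) I J I' J' :
  size I = size J -> size I' = size J' ->
  is_path_graph mu I J -> is_path_graph mu I' J' ->
  exists v : 'S_n, forall w : 'S_n,
    ([seq (w ^ v)%g i | i <- I'] == J') = ([seq w i | i <- I] == J).
Proof.
move=> sz sz' [ps [sh pf e]] [ps' [sh' pf' e']].
have u : uniq (flatten ps) by rewrite (perm_uniq pf) enum_uniq.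
have u' : uniq (flatten ps') by rewrite (perm_uniq pf') enum_uniq.
have s : size (flatten ps) = size (flatten ps').
  by rewrite (perm_size pf) (perm_size pf').
have mem x : x \in flatten ps by rewrite (perm_mem pf) mem_enum.
pose g x := nth x (flatten ps') (index x (flatten ps)).
have lt x : (index x (flatten ps) < size (flatten ps'))%N.
  by rewrite -s index_mem.
have g_inj : injective g.
  move=> x y; rewrite /g (set_nth_default x) // => /eqP.
  rewrite nth_uniq // => /eqP eq_i.
  by rewrite -(nth_index x (mem x)) eq_i nth_index.
have gps : ps' = [seq [seq g x | x <- p] | p <- ps].
  rewrite -[LHS]flattenK -[RHS]flattenK; congr reshape.
    rewrite /shape sh' -sh -map_comp; apply: eq_map => p /=.
    by rewrite size_map.
  rewrite -map_flatten; case: (flatten ps) (flatten ps') @g u s {lt g_inj pf mem pf' u'}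
    => [|x0 r] r' g ur sr.
    by apply/size0nil.
  rewrite /g; apply: (@eq_from_nth _ x0) => [|i ir]; first by rewrite size_map.
  have ir1 : (i < size (x0 :: r))%N by rewrite sr.
  rewrite (nth_map x0 x0 (fun x => nth x r' (index x (x0 :: r))) ir1).
  by rewrite index_uniq // (set_nth_default x0).
exists (perm g_inj) => w.
apply/pp_imageP/pp_imageP => // H x y.
  rewrite e => xy; have : pp_edge I' J' (g x) (g y).
    rewrite e' gps path_edges_map.
    by apply/mapP; exists (x, y).
  move/H; rewrite -(permE g_inj x) -(permE g_inj y) permJ.
  exact: perm_inj.
rewrite e' gps path_edges_map => /mapP[[a b] /= ab [-> ->]].
by rewrite -(permE g_inj a) -(permE g_inj b) permJ (H a b) ?e.
Qed.

Lemma path_psumE (N : nat) (mu : seq nat) I J :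
  is_part_of n mu -> is_partial_perm I J -> is_path_graph mu I J ->
  atomic N I J = path_psum N mu.
Proof.
move=> hmu /and3P[/eqP sIJ _ _] gIJ.
have [/and3P[/eqP sE _ _] gE] := path_psum_graph hmu.
have [v hv] := path_graph_conj sIJ sE gIJ gE.
rewrite /path_psum /atomic /frobenius_ch; congr (_ *: (_ *: _)).
apply: eq_bigr => w _; congr (_ *: _); rewrite /reynolds; congr (_ * _).
rewrite [RHS](reindex_inj (mulgI v^-1%g)) /=.
apply: eq_bigr => x _; rewrite /pp_indicator -hv.
by rewrite invMg invgK conjgE !mulgA.
Qed.

End Atomic.

(* Main.v *)
Require Import Defs.
From mathcomp Require Import all_boot all_order all_algebra all_fingroup.
From mathcomp Require Import mpoly zify ring.
Import GRing.Theory.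
Local Open Scope ring_scope.

Set Implicit Arguments.
Unset Strict Implicit.
Unset Printing Implicit Defensive.

(* Let k be the length of mu.  Expanding the power sums over colourings of the
   vertices that are constant on cycles, the path power sum becomes the sum over
   s in S_k of sum_(i_1 <= ... <= i_k) prod_j x_(i_j)^(mu_(s j)).  Up to the
   factor m(mu)!, this is the coefficient of t_(mu_1) ... t_(mu_k) in h_k(y),
   where y_i = sum_d t_d x_i^d.

   Multiply h_k(y) by the Vandermonde determinant.  If R is the lowest row whose
   variable may still be used, then h_k = h_k(without that variable) + y h_(k-1),
   and multiplying the column x^b by y moves a bead from b to the positions b + d.
   Two beads on the same position give 0, and sorting the beads gives the sign
   (-1)^height of the ribbon added to the partition.  Hence h_k(y) a_delta is a
   signed sum of alternants over sequences of ribbon additions whose tails lie in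
   weakly decreasing rows, which is the same as tails in strictly increasing
   columns.  Finally a_(la + delta) = a_delta s_la, by induction on the number of
   variables. *)

(** For R < N, [hsum] is no longer defined as a product: variables are deleted according to the
    column that each permutation of the Leibniz expansion assigns to them. Exchanging two exponents
    reverses the sign when R does not separate their columns. This is always the case here, because
    a moving bead meets only beads of rows above its own, and all of these rows are still allowed.
    Hence the rows are removed from the bottom.

    Increasing tail columns match this order. A ribbon with tail row r has its tail in column la r,
    and afterwards row r is longer than la r. So the next tail lies further right exactly when it
    lies in row r or above.

    The t_d are variables over the ring that contains the x_i, so that alternants are constants when
    a coefficient is read off. The identity is first obtained multiplied by a_delta, a nonzero
    element of an integral domain. Tilings whose shape has more than N rows correspond to no moves
    of N beads, and their Schur polynomials in N variables vanish. *)

(** * Complete homogeneous sums *)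

(* The multisets of k entries of a list, each listed once, in list order. *)
Fixpoint msel (T : Type) (k : nat) : seq T -> seq (seq T) :=
  if k is k'.+1 then
    fix aux xs := if xs is x :: xs' then
      [seq x :: s | s <- msel k' xs] ++ aux xs' else [::]
  else fun=> [:: [::]].

Lemma msel_cons (T : Type) k (x : T) xs :
  msel k.+1 (x :: xs) = [seq x :: s | s <- msel k (x :: xs)] ++ msel k.+1 xs.
Proof. by []. Qed.

Lemma msel_map (T S : Type) (f : T -> S) k xs :
  msel k (map f xs) = [seq map f s | s <- msel k xs].
Proof.
elim: k xs => [//|k IHk] xs; elim: xs => [//|x xs IH].
by rewrite map_cons !msel_cons map_cat -map_cons IHk IH -!map_comp.
Qed.

Lemma mem_msel (T : eqType) (r : rel T) k xs s :
    transitive r -> irreflexive r -> sorted r xs ->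
  (s \in msel k xs) =
    [&& size s == k, all (mem xs) s
      & sorted (fun u v => (u == v) || r u v) s].
Proof.
move=> rtr rirr; elim: k xs s => [|k IHk] xs s.
  by move=> _; case: s.
elim: xs s => [|x xs IH] s sxs.
  by case: s => //= a s; rewrite andbF.
rewrite msel_cons mem_cat IH; last by move: sxs => /=; apply: path_sorted.
have rx : all (r x) xs by apply: order_path_min.
have xNxs : x \notin xs.
  by apply/negP => /(allP rx); rewrite rirr.
case: s => [|a s].
  rewrite /= orbF; apply/mapP => -[? _ //].
have e : ((a :: s) \in [seq x :: s0 | s0 <- msel k (x :: xs)])
   = (a == x) && (s \in msel k (x :: xs)).
  apply/mapP/andP => [[t ht [-> ->]]|[/eqP -> h]]; last by exists s.
  by rewrite eqxx.
rewrite e IHk //=.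
have tr' : transitive (fun u v => (u == v) || r u v).
  move=> u v w /orP[/eqP->//|h1] /orP[/eqP<-|h2]; first by rewrite h1 orbT.
  by rewrite (rtr _ _ _ h1 h2) orbT.
rewrite path_sortedE // eqSS !inE.
have [->|ax] /= := eqVneq a x.
  rewrite (negPf xNxs) andbF orbF; case: eqP => //= _.
  case: (boolP (all (fun x0 => x0 \in x :: xs) s)) => //= h.
  suff -> : all (fun v => (x == v) || r x v) s by [].
  apply/allP => v /(allP h); rewrite inE => /orP[/eqP->|/(allP rx)->].
    by rewrite eqxx.
  by rewrite orbT.
case: (boolP (a \in xs)) => [axs|]; last by rewrite andbF.
case: eqP => //= _.
case: (boolP (all _ s)) => [h|h].
  suff -> : all (mem (x :: xs)) s by [].
  by apply/allP => v /(allP h) /= hv; rewrite inE hv orbT.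
apply/esym/negbTE; apply/negP => /and3P[h1 h2 _]; move/negP: h; apply.
apply/allP => v vs; move: (allP h1 v vs); rewrite /= inE => /orP[/eqP ve|//].
move: (allP h2 v vs); rewrite ve => /orP[/eqP ea|]; first by rewrite ea eqxx in ax.
by move=> rax; move: (rtr _ _ _ rax (allP rx a axs)); rewrite rirr.
Qed.

Lemma msel_sub (T : eqType) k (xs s : seq T) : s \in msel k xs -> {subset s <= xs}.
Proof.
elim: k xs s => [|k IHk] xs s; first by rewrite inE => /eqP ->.
elim: xs => [//|z zs IHz]; rewrite msel_cons mem_cat.
case/orP=> [/mapP[t ht ->] y|/IHz h y /h yz]; last by rewrite inE yz orbT.
by rewrite inE => /orP[/eqP->|yt]; [exact: mem_head | exact: IHk _ _ ht _ yt].
Qed.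

Lemma uniq_msel (T : eqType) k (xs : seq T) : uniq xs -> uniq (msel k xs).
Proof.
elim: k xs => [//|k IHk] xs; elim: xs => [//|x xs IH] /[dup] uxs /andP[xNxs ux].
rewrite msel_cons cat_uniq IH // andbT map_inj_uniq => [|? ? [] //].
rewrite (IHk (x :: xs)) //=; apply/hasPn => s hs; apply/negP => /mapP[t _ es].
by move: (@msel_sub _ k.+1 _ _ hs x); rewrite es mem_head (negPf xNxs) => /(_ isT).
Qed.

Section CompleteHomogeneous.
Variable K : comNzRingType.
Implicit Types ys : seq K.

Definition hsym k ys : K := \sum_(s <- msel k ys) \prod_(y <- s) y.

Lemma hsym0 ys : hsym 0 ys = 1.
Proof. by rewrite /hsym big_seq1 big_nil. Qed.

Lemma hsym_nil k : hsym k.+1 [::] = 0.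
Proof. by rewrite /hsym big_nil. Qed.

Lemma hsym_cons k y ys :
  hsym k.+1 (y :: ys) = y * hsym k (y :: ys) + hsym k.+1 ys.
Proof.
rewrite /hsym msel_cons big_cat big_map mulr_sumr /=; congr (_ + _).
by apply: eq_bigr => s _; rewrite big_cons.
Qed.

(** Two rounds of [hsym_cons] give xy h_k(x,y,ys) + x h_(k+1)(x,ys) + y h_(k+1)(y,ys) + h_(k+2)(ys),
    which is symmetric once the induction hypothesis exchanges x and y in lower degrees. *)
Lemma hsym_swap k x y ys : hsym k (x :: y :: ys) = hsym k (y :: x :: ys).
Proof.
elim/ltn_ind: k => -[|[|k]] IH; first by rewrite !hsym0.
  by rewrite !hsym_cons !hsym0; ring.
have e1 : hsym k.+1 [:: x, y & ys] = y * hsym k [:: y, x & ys] + hsym k.+1 (x :: ys).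
  by rewrite IH // hsym_cons.
have e2 : hsym k.+1 [:: y, x & ys] = x * hsym k [:: y, x & ys] + hsym k.+1 (y :: ys).
  by rewrite -IH // hsym_cons (IH k).
rewrite (hsym_cons k.+1 x) (hsym_cons k.+1 y) e1 (hsym_cons k.+1 y (x :: ys)).
by rewrite (hsym_cons k.+1 x ys) e2; ring.
Qed.

Lemma hsym_cons_eq y ys zs :
  (forall k, hsym k ys = hsym k zs) ->
  forall k, hsym k (y :: ys) = hsym k (y :: zs).
Proof.
move=> h; elim=> [|k IH]; first by rewrite !hsym0.
by rewrite !hsym_cons IH h.
Qed.

Lemma perm_hsym k ys zs : perm_eq ys zs -> hsym k ys = hsym k zs.
Proof.
have ins y us vs m : hsym m (y :: us ++ vs) = hsym m (us ++ y :: vs).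
  elim: us m => [//|u us IH] m /=; rewrite hsym_swap.
  by apply: hsym_cons_eq => j; apply: IH.
elim: ys zs k => [|y ys IH] zs k h.
  by move: h; rewrite perm_sym => /perm_nilP ->.
have /splitPr yzs : y \in zs by rewrite -(perm_mem h) mem_head.
case: yzs h => us vs h; rewrite -ins.
apply: hsym_cons_eq => j; apply: IH.
by move: h; rewrite perm_sym perm_catC /= perm_cons perm_catC perm_sym.
Qed.

End CompleteHomogeneous.

(** * Alternants and bead moves *)

Section Alternants.
Variables (K : comNzRingType) (x : nat -> K).

Definition alt N (b : nat -> nat) : K :=
  \det (\matrix_(i < N, j < N) x i ^+ b j).

Variable (y : nat -> K).

(* alt b times h_k, except that in the term of s only the variables placed in
   one of the first R columns enter h_k. *)
Definition hsum N k R (b : nat -> nat) : K :=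
  \sum_(s : 'S_N) (-1) ^+ s * (\prod_(i < N) x i ^+ b (s i)) *
    hsym k [seq y i | i : 'I_N <- enum 'I_N & (s i < R)%N].

Lemma hsum_full N k (b : nat -> nat) :
  hsum N k N b = alt N b * hsym k [seq y i | i : 'I_N <- enum 'I_N].
Proof.
rewrite /alt /determinant mulr_suml; apply: eq_bigr => s _.
congr (_ * _ * hsym _ _).
  by apply: eq_bigr => i _; rewrite mxE.
by congr map; apply/all_filterP/allP => i _; apply: ltn_ord.
Qed.

Lemma hsum0 N R (b : nat -> nat) : hsum N 0 R b = alt N b.
Proof.
rewrite /alt /determinant; apply: eq_bigr => s _.
by rewrite hsym0 mulr1; congr (_ * _); apply: eq_bigr => i _; rewrite mxE.
Qed.

Lemma hsumS0 N k (b : nat -> nat) : hsum N k.+1 0 b = 0.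
Proof.
apply: big1 => s _.
have -> : [seq i <- enum 'I_N | (s i < 0)%N] = [::] by elim: (enum _).
by rewrite hsym_nil mulr0.
Qed.

(** Substituting [s * p] for [s] in the Leibniz sum brings out the sign of [p]; the second
    hypothesis keeps the variables that enter h_k. *)
Lemma hsum_perm N k R (b : nat -> nat) (p : 'S_N) (c : nat -> nat) :
  (forall i : 'I_N, c i = b (p i)) ->
  (forall i : 'I_N, (p i < R)%N = (i < R)%N) ->
  hsum N k R c = (-1) ^+ p * hsum N k R b.
Proof.
move=> e hp; rewrite /hsum mulr_sumr [RHS](reindex_inj (mulIg p)) /=.
apply: eq_bigr => s _; rewrite odd_permM signr_addb !mulrA; congr (_ * hsym _ _).
- rewrite -[_ * _ * _ ^+ p]mulrA [X in _ = X * _]mulrCA -signr_addb addbb mulr1.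
  by congr (_ * _); apply: eq_bigr => i _; rewrite e permM.
- by congr map; apply: eq_filter => i; rewrite permM hp.
Qed.

(** Multiplication by the transposition of [j] and [l] pairs even with odd terms. It keeps the
    monomial, as the exponents agree, and it keeps h_k, as both columns are allowed. *)
Lemma hsum_collision N k R (b : nat -> nat) (j l : 'I_N) :
  j != l -> b j = b l -> (j < R)%N -> (l < R)%N -> hsum N k R b = 0.
Proof.
move=> jl e jR lR; rewrite /hsum (bigID (fun s : 'S_N => odd_perm s)) /=.
rewrite (reindex_inj (mulIg (tperm j l))) /=.
set A := \sum_(_ | _) _; set B := \sum_(_ | _) _.
suff -> : A = - B by rewrite addNr.
rewrite /A /B -sumrN; apply: eq_big => [s|s hs].
  by rewrite odd_permM odd_tperm jl addbT.
rewrite odd_permM odd_tperm jl addbT.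
move: hs; rewrite odd_permM odd_tperm jl addbT => hs.
rewrite hs (negPf hs) expr1 expr0 !mulNr !mul1r; congr (- (_ * hsym _ _)).
  apply: eq_bigr => i _; rewrite permM; congr (_ ^+ _).
  by case: tpermP => [->|->|].
congr map; apply: eq_filter => i; rewrite permM.
by case: tpermP => [->|->|//]; rewrite jR lR.
Qed.

Lemma hsum_rec N k R (b : nat -> nat) n (tau : nat -> K) :
  (R < N)%N ->
  (forall i, y i = \sum_(d <- iota 1 n) tau d * x i ^+ d) ->
  hsum N k.+1 R.+1 b = hsum N k.+1 R b +
   \sum_(d <- iota 1 n) tau d *
     hsum N k R.+1 (fun j => if j == R then b R + d else b j)%N.
Proof.
move=> RN yE.
under [X in _ + X]eq_bigr do rewrite /hsum mulr_sumr.
rewrite exchange_big /= /hsum -big_split /=; apply: eq_bigr => s _.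
(* [i0] is the variable that [s] places in column R, the only one that the bound [R.+1] allows and R
   does not. *)
pose i0 : 'I_N := (s^-1)%g (Ordinal RN).
have si0 : s i0 = Ordinal RN by rewrite /i0 permKV.
have si0P i : i != i0 -> (s i == R :> nat) = false.
  by apply: contraNF => /eqP e; apply/eqP/(@perm_inj _ s)/val_inj; rewrite si0.
set L := [seq i <- enum 'I_N | (s i < R)%N].
set L' := [seq i <- enum 'I_N | (s i < R.+1)%N].
have pL : perm_eq L' (i0 :: L).
  apply: uniq_perm.
  - by rewrite filter_uniq ?enum_uniq.
  - by rewrite /= filter_uniq ?enum_uniq // mem_filter si0 ltnn.
  move=> i; rewrite in_cons mem_filter [i \in L]mem_filter !mem_enum !andbT ltnS leq_eqVlt.
  congr (_ || _).
  have [->|/si0P//] := eqVneq i i0; by rewrite si0 eqxx.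
have hE m : hsym m [seq y i | i : 'I_N <- L'] = hsym m (y i0 :: [seq y i | i : 'I_N <- L]).
  exact/perm_hsym/(perm_map (fun i : 'I_N => y i) pL).
rewrite !hE hsym_cons mulrDr addrC; congr (_ + _).
rewrite {1}yE mulr_suml mulr_sumr; apply: eq_bigr => d _.
rewrite (bigD1 i0) //= [in RHS](bigD1 i0) //= si0 eqxx exprD.
rewrite [in RHS](eq_bigr (fun i : 'I_N => x i ^+ b (s i))); last first.
  by move=> i /si0P ->.
move: (\prod_(i < N | i != i0) _) (x i0 ^+ b R) (x i0 ^+ d) (_ ^+ s) (hsym k _).
by move=> A u v e B; ring.
Qed.

End Alternants.

Definition decr (la : nat -> nat) : Prop := forall i, (la i.+1 <= la i)%N.

Lemma decr_le la i j : decr la -> (i <= j)%N -> (la j <= la i)%N.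
Proof.
move=> h; elim: j => [|j IH]; first by rewrite leqn0 => /eqP->.
rewrite leq_eqVlt => /orP[/eqP->//|]; rewrite ltnS => /IH; exact: leq_trans.
Qed.

(* Moving the bead of row r by d positions: it jumps over the beads of the rows
   step_row, ..., r-1, and the move is legal iff its target is free. *)
Definition step_row (la : nat -> nat) r d : nat :=
  find (fun i => la i + r <= la r + d + i)%N (iota 0 r).

Definition step_ok (la : nat -> nat) r d : bool :=
  all (fun i => la i + r != la r + d + i)%N (iota 0 r).

Definition step (la : nat -> nat) r d (i : nat) : nat :=
  let a := step_row la r d in
  if (i < a)%N || (r < i)%N then la i
  else if i == a then (la r + d - (r - a))%N else (la i.-1).+1.

Section Step.
Variables (la : nat -> nat) (r d : nat).
Hypotheses (la_decr : decr la).

Lemma step_row_le : (step_row la r d <= r)%N.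
Proof. by rewrite -[X in (_ <= X)%N](size_iota 0 r) find_size. Qed.

Lemma decr_shift i j : (i <= j)%N -> (la j + i <= la i + j)%N.
Proof. by move=> ij; have := decr_le la_decr ij; lia. Qed.

(** Bead positions decrease strictly with the row, so the rows whose bead lies beyond the target
    form an initial interval, which ends where [find] stops. *)
Lemma step_row_lt i : (i <= r)%N ->
  (i < step_row la r d)%N = (la r + d + i < la i + r)%N.
Proof.
move=> ir; apply/idP/idP => [h|h].
  have := before_find 0%N h; rewrite nth_iota ?add0n => [/negbT|]; first lia.
  exact: leq_trans step_row_le.
rewrite ltnNge; apply/negP => ai.
have [e|ar] := eqVneq (step_row la r d) r.
  by have e2 : i = r by [lia]; rewrite e2 in h; lia.
have ha : has (fun i => la i + r <= la r + d + i)%N (iota 0 r).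
  by rewrite has_find size_iota ltn_neqAle ar step_row_le.
have := nth_find 0%N ha; rewrite -/(step_row la r d) nth_iota ?add0n.
  by have := decr_shift ai; lia.
by rewrite ltn_neqAle ar step_row_le.
Qed.

Lemma step_okP i : step_ok la r d -> (i < r)%N -> (la i + r)%N <> (la r + d + i)%N.
Proof. by move=> /allP/(_ i); rewrite mem_iota /= => h /h /eqP. Qed.

Hypothesis (ok : step_ok la r d).
Hypothesis (d_gt0 : (0 < d)%N).

(** Legality makes the target strictly exceed the beads of rows a to r-1. This strictness leaves
    room below the moved bead for the part of row a, increased by one. *)
Lemma step_decr : decr (step la r d).
Proof.
move=> i; rewrite /step; set a := step_row la r d.
have ar : (a <= r)%N := step_row_le.
have hlt j : (j < a)%N -> (la r + d + j < la j + r)%N.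
  by move=> ja; rewrite -step_row_lt //; lia.
have hge j : (a <= j)%N -> (j < r)%N -> (la j + r < la r + d + j)%N.
  move=> aj jr; have := @step_okP j ok jr; move: aj; rewrite leqNgt step_row_lt; lia.
have h1 := la_decr i; have h3 := hlt i; have h4 := hge i.
have h6 := decr_le la_decr (leq_pred i).
case: (ltnP i.+1 a) => i1a; first by rewrite (ltn_trans (ltnSn i) i1a).
case: (ltnP i a) => ia /=.
  have e : i.+1 = a by lia.
  by rewrite ltnNge -e in ar *; rewrite ar /= eqxx; lia.
case: (ltnP r i.+1) => ri1; case: (ltnP r i) => ri /=; try lia.
  have e : i = r by lia.
  by subst i; case: eqP => [e|_]; lia.
have -> : (i.+1 == a) = false by lia.
by case: eqP => [e|_]; lia.
Qed.

End Step.

(* The bead positions of la, that is, la + delta on N rows. *)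
Definition beta N (la : nat -> nat) (j : nat) : nat := (la j + (N - j.+1))%N.

Section HsumMoves.
Variables (K : comNzRingType) (x y tau : nat -> K) (N n : nat).
Hypothesis yE : forall i, y i = \sum_(d <- iota 1 n) tau d * x i ^+ d.

Lemma hsum_step k la r d : (r < N)%N -> decr la -> (0 < d)%N ->
  hsum x y N k r.+1 (fun j => if j == r then beta N la r + d else beta N la j)%N
  = if step_ok la r d then
      (-1) ^+ (r - step_row la r d) * hsum x y N k r.+1 (beta N (step la r d))
    else 0.
Proof.
move=> rN dla d0; have [ok|] := boolP (step_ok la r d); last first.
  (* The target is already occupied by the bead of some row i < r, and both rows are allowed. *)
  case/allPn => i; rewrite mem_iota /= negbK add0n => ir /eqP e.
  have iN : (i < N)%N by lia.
  apply: (@hsum_collision _ x y N k r.+1 _ (Ordinal iN) (Ordinal rN)) => //=.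
  - by rewrite -val_eqE /=; lia.
  - by rewrite eqxx (ltn_eqF ir) /beta; lia.
  - by lia.
case: N rN => [//|M] rN.
set a := step_row la r d; have ar : (a <= r)%N := step_row_le la r d.
have aN : (a < M.+1)%N by lia.
(* [p] sends a to r and is increasing elsewhere: it is the cycle that sorts the beads, of sign
   (-1)^(a+r) = (-1)^(r-a). *)
pose p := lift_perm (Ordinal aN) (Ordinal rN) 1%g.
set b := fun j => _.
have pE (i : 'I_M.+1) : (p i : nat) = (if (i < a)%N || (r < i)%N then (i : nat) else
     if i == a :> nat then r else i.-1).
  rewrite /p; case: (unliftP (Ordinal aN) i) => [k0 ->|->].
    rewrite lift_perm_lift perm1 /= /bump -/a.
    case: (leqP a k0) => h1; case: (leqP r k0) => h2; rewrite ?add1n ?add0n.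
    - by have -> : (k0.+1 < a)%N || (r < k0.+1)%N by [lia].
    - have -> : (k0.+1 < a)%N || (r < k0.+1)%N = false by lia.
      by have -> : (k0.+1 == a) = false by [lia].
    - by move: (leq_trans h1 ar); rewrite ltnNge h2.
    - by rewrite h1.
  by rewrite lift_perm_id /= ltnn eqxx; case: ifP => //; lia.
have hp : hsum x y M.+1 k r.+1 (beta M.+1 (step la r d)) =
    (-1) ^+ p * hsum x y M.+1 k r.+1 b.
  apply: hsum_perm => i.
    rewrite pE /b /beta /step -/a; have := ltn_ord i.
    have hok := @step_okP la r d a ok; have hlt := @step_row_lt la r d dla a ar.
    rewrite -/a ltnn in hlt.
    have hl2 j : (j < r)%N -> (la r <= la j)%N by move=> ?; apply: decr_le => //; lia.
    have := hl2 a.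
    case: (ltnP i a) => h1 /=; first by have -> : (i == r :> nat) = false by lia.
    case: (ltnP r i) => h2 /=; first by have -> : (i == r :> nat) = false by lia.
    case: (eqVneq (i : nat) a) => [->|h3]; first by rewrite eqxx; lia.
    by have -> : (i.-1 == r :> nat) = false; lia.
  rewrite pE; repeat case: ifP; lia.
rewrite hp mulrA -signr_odd -signr_addb odd_lift_perm odd_perm1 addbF /=.
by rewrite oddB // [odd a (+) _]addbC addbb mul1r.
Qed.

(** A move is a pair (row, length). The next bound is [m.1.+1], so rows decrease weakly and a row
    may move repeatedly. *)
Fixpoint mvalid la R (s : seq (nat * nat)) : bool :=
  if s is m :: s' then
    [&& (m.1 < R)%N, step_ok la m.1 m.2 & mvalid (step la m.1 m.2) m.1.+1 s']
  else true.

Fixpoint mfinal la (s : seq (nat * nat)) : nat -> nat :=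
  if s is m :: s' then mfinal (step la m.1 m.2) s' else la.

Fixpoint mheight la (s : seq (nat * nat)) : nat :=
  if s is m :: s' then
    (m.1 - step_row la m.1 m.2 + mheight (step la m.1 m.2) s')%N
  else 0%N.

Fixpoint allmoves k : seq (seq (nat * nat)) :=
  if k is k'.+1 then
    [seq m :: s | m <- [seq (r, d) | r <- iota 0 N, d <- iota 1 n],
                  s <- allmoves k']
  else [:: [::]].

(** Iterating [hsum_rec] down to R = 0 leaves one term for each row and length of the first move;
    with no variable left, h_(k+1) is 0. *)
Lemma hsum_moves1 k R la : decr la -> (R <= N)%N ->
  hsum x y N k.+1 R (beta N la) =
  \sum_(0 <= r < R) \sum_(d <- iota 1 n | step_ok la r d)
    tau d * (-1) ^+ (r - step_row la r d) *
      hsum x y N k r.+1 (beta N (step la r d)).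
Proof.
move=> dla; elim: R => [|R IH] RN; first by rewrite hsumS0 big_geq.
rewrite (hsum_rec _ _ RN yE) big_nat_recr //= IH; last exact: ltnW.
congr (_ + _); rewrite [RHS]big_mkcond !big_seq; apply: eq_bigr => d.
rewrite mem_iota => /andP[d0 _]; rewrite hsum_step //.
by case: ifP; rewrite ?mulr0 ?mulrA.
Qed.

Lemma hsum_moves k R la : decr la -> (R <= N)%N ->
  hsum x y N k R (beta N la) =
  \sum_(s <- allmoves k | mvalid la R s)
     (\prod_(m <- s) tau m.2) *
       ((-1) ^+ mheight la s * alt x N (beta N (mfinal la s))).
Proof.
elim: k R la => [|k IH] R la dla RN.
  by rewrite hsum0 /= big_mkcond big_seq1 /= big_nil mul1r mul1r.
rewrite hsum_moves1 //= [RHS]big_mkcond big_allpairs_dep /= big_allpairs_dep /=.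
rewrite [in RHS](_ : iota 0 N = index_iota 0 N); last by rewrite /index_iota subn0.
(* Moves that begin in a row from R on are rejected by [mvalid]. *)
rewrite [RHS](big_cat_nat (leq0n R) RN) /= [X in _ + X]big1_seq ?addr0 => [|r]; last first.
  rewrite mem_index_iota => /andP[_ /andP[Rr _]].
  apply: big1_seq => d _; apply: big1_seq => s _.
  by rewrite ltnNge Rr.
rewrite !big_nat; apply: eq_bigr => r /andP[_ rR].
rewrite big_mkcond big_seq [RHS]big_seq; apply: eq_bigr => d.
rewrite mem_iota => /andP[d0 _]; rewrite rR /=.
case: ifP => ok; last by rewrite big1.
rewrite IH; [|exact: step_decr|exact: leq_trans RN].
rewrite mulr_sumr [RHS]big_mkcond [RHS]big_mkcond /= big_mkcond; apply: eq_bigr => s _.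
case: ifP => // _; rewrite big_cons /= exprD; ring.
Qed.

Lemma mem_allmoves k s : (s \in allmoves k) =
  (size s == k) && all (fun m => (m.1 < N)%N && (0 < m.2 <= n)%N) s.
Proof.
elim: k s => [|k IH] s; first by rewrite inE; case: s.
case: s => [|m s] /=; first by apply/allpairsP => -[[? ?] []].
rewrite eqSS andbCA -IH.
have -> : (m.1 < N)%N && (0 < m.2 <= n)%N =
    (m \in [seq (r, d) | r <- iota 0 N, d <- iota 1 n]).
  apply/idP/allpairsP => [h|[[u v] /= [h1 h2 ->]]].
    by exists m; rewrite -surjective_pairing !mem_iota; split=> //; lia.
  by rewrite !mem_iota in h1 h2 *; rewrite /=; lia.
apply/allpairsP/andP => [[[u v] /= [? ? [-> ->]]]|[? ?]]; first by split.
by exists (m, s).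
Qed.

Lemma uniq_allmoves k : uniq (allmoves k).
Proof.
elim: k => [//|k IH] /=; apply: allpairs_uniq => //.
  by apply: allpairs_uniq; rewrite ?iota_uniq // => -[? ?] [? ?] _ _ [-> ->].
by move=> [? ?] [? ?] _ _ [-> ->].
Qed.

End HsumMoves.

(** * Schur polynomials as quotients of alternants *)

Lemma det_colsum (K : comNzRingType) n (J : finType) (Q : 'I_n -> pred J)
    (F : 'I_n -> J -> 'I_n -> K) :
  \det (\matrix_(i, j) \sum_(v | Q j v) F j v i) =
  \sum_(f : {ffun 'I_n -> J} | [forall j, Q j (f j)])
    \det (\matrix_(i, j) F j (f j) i).
Proof.
transitivity (\sum_(s : 'S_n) (-1) ^+ s *
    \sum_(f : {ffun 'I_n -> J} | [forall j, Q j (f j)]) \prod_j F j (f j) (s j)).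
  rewrite -det_tr; apply: eq_bigr => s _; congr (_ * _).
  under eq_bigr do rewrite !mxE.
  rewrite (bigA_distr_big_dep _ (fun j v => F j v (s j))) /=.
  by apply: eq_bigl => f; apply/familyP/forallP.
under eq_bigr do rewrite mulr_sumr.
rewrite exchange_big /=; apply: eq_bigr => f _; rewrite -[RHS]det_tr.
apply: eq_bigr => s _; congr (_ * _).
by apply: eq_bigr => j _; rewrite !mxE.
Qed.

Lemma det_scale_col (K : comNzRingType) n (A : 'I_n -> 'I_n -> K) (c : 'I_n -> K) :
  \det (\matrix_(i, j) (A i j * c j)) = \det (\matrix_(i, j) A i j) * \prod_j c j.
Proof.
transitivity (\det ((\matrix_(i, j) A i j) *m diag_mx (\row_j c j))).
  by congr (\det _); apply/matrixP => i j; rewrite mul_mx_diag !mxE.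
by rewrite det_mulmx det_diag; congr (_ * _); apply: eq_bigr => j _; rewrite mxE.
Qed.

Lemma det_scale_row (K : comNzRingType) n (A : 'I_n -> 'I_n -> K) (c : 'I_n -> K) :
  \det (\matrix_(i, j) (c i * A i j)) = \prod_i c i * \det (\matrix_(i, j) A i j).
Proof.
transitivity (\det (diag_mx (\row_i c i) *m (\matrix_(i, j) A i j))).
  by congr (\det _); apply/matrixP => i j; rewrite mul_diag_mx !mxE.
by rewrite det_mulmx det_diag; congr (_ * _); apply: eq_bigr => j _; rewrite mxE.
Qed.

(** Row lengths range over a finite type, so that sums over interlacing shapes are finite; rows from
    N on are empty. *)
Definition ext N B (nu : {ffun 'I_N -> 'I_B}) (j : nat) : nat :=
  if insub j is Some j' then nu j' : nat else 0%N.

Lemma extE N B (nu : {ffun 'I_N -> 'I_B}) (j : 'I_N) : ext nu j = nu j.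
Proof. by rewrite /ext valK. Qed.

Lemma ext_ge N B (nu : {ffun 'I_N -> 'I_B}) j : (N <= j)%N -> ext nu j = 0%N.
Proof. by move=> h; rewrite /ext insubF // ltnNge h. Qed.

(** For [la] with at most N+1 rows, this says that la/nu is a horizontal strip. *)
Definition interlace N B (la : nat -> nat) (nu : {ffun 'I_N -> 'I_B}) : bool :=
  [forall j : 'I_N, (la j.+1 <= nu j <= la j)%N].

Section Branching.
Variables (K : comNzRingType) (x : nat -> K).

Lemma geom_interval (X Y : K) p q e : (p <= q)%N ->
  X ^+ (q + e).+1 - Y ^+ (q - p).+1 * X ^+ (p + e) =
  (X - Y) * \sum_(p <= v < q.+1) X ^+ (v + e) * Y ^+ (q - v).
Proof.
move=> pq; rewrite mulr_sumr.
pose g v := X ^+ (v + e) * Y ^+ (q.+1 - v).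
rewrite (eq_big_nat _ _ (F2 := fun v => g v.+1 - g v)).
  rewrite telescope_sumr ?leqW // /g subnn expr0 mulr1 addSn subSn //.
  by congr (_ - _); rewrite mulrC.
move=> v /andP[_ vq]; rewrite /g subSS subSn // addSn !exprS; ring.
Qed.

(* Subtract from column j the column j+1 times x_N^(b_j - b_(j+1)): the last row
   becomes (0, ..., 0, x_N^(b_N)), and the entries of the other rows become
   (x_i - x_N) times geometric sums whose exponents interlace b. *)
Lemma alt_branch N B la : decr la -> (la 0 < B)%N -> la N.+1 = 0%N ->
  alt x N.+1 (beta N.+1 la) =
  \prod_(i < N) (x i - x N) *
  \sum_(nu : {ffun 'I_N -> 'I_B} | interlace la nu)
    alt x N (beta N (ext nu)) * x N ^+ (\sum_(j < N.+1) (la j - ext nu j)).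
Proof.
move=> dla laB laN; rewrite /alt.
set b := beta N.+1 la; set A := \matrix_(i, j) _.
(* The exponent is b j - b (j+1). The last column has no successor, whence the value 0 at j = N. The
   matrix [U] of these column operations is unitriangular. *)
pose c (j : nat) := if (j < N)%N then x N ^+ (la j - la j.+1).+1 else 0.
pose U : 'M[K]_N.+1 :=
  \matrix_(l, j) ((l == j)%:R - (l == j.+1 :> nat)%:R * c j).
have detU : \det U = 1.
  rewrite det_trig.
    by rewrite big1 // => i _; rewrite !mxE eqxx (ltn_eqF (ltnSn i)) mul0r subr0.
  apply/is_trig_mxP => i j ij; rewrite !mxE.
  have -> : (i == j) = false by rewrite -val_eqE /=; lia.
  have -> : (i == j.+1 :> nat) = false by lia.
  by rewrite mul0r subr0.
have AU (i j : 'I_N.+1) : (A *m U) i j = x i ^+ b j - c j * x i ^+ b j.+1.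
  rewrite !mxE (eq_bigr (fun l : 'I_N.+1 => x i ^+ b l * (l == j)%:R
     - x i ^+ b l * (l == j.+1 :> nat)%:R * c j)); last first.
    by move=> l _; rewrite !mxE mulrBr mulrA.
  rewrite sumrB (bigD1 j) //= eqxx mulr1 big1 ?addr0; last first.
    by move=> l /negPf ->; rewrite mulr0.
  congr (_ - _); rewrite /c; case: ifP => jN; last first.
    by rewrite mul0r big1 // => l _; rewrite mulr0.
  rewrite -ltnS in jN; rewrite (bigD1 (Ordinal jN)) //= eqxx mulr1 mulrC big1 ?addr0 //.
  by move=> l; rewrite -val_eqE /= => /negPf ->; rewrite mulr0 mul0r.
have bS (j : nat) : (j < N)%N ->
    b j = (la j + (N - j.+1)).+1 /\ b j.+1 = (la j.+1 + (N - j.+1))%N.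
  by move=> jN; rewrite /b /beta; lia.
have AUlt (i : 'I_N.+1) (j : 'I_N) : (A *m U) i (widen_ord (leqnSn N) j) =
    (x i - x N) * \sum_(v < B | (la j.+1 <= v <= la j)%N)
       x i ^+ (v + (N - j.+1)) * x N ^+ (la j - v).
  rewrite AU /c /= ltn_ord; have [-> ->] := bS j (ltn_ord j).
  rewrite geom_interval; last exact: dla.
  have laj : (la j < B)%N by apply: leq_ltn_trans laB; apply: decr_le.
  congr (_ * _); rewrite (@big_nat_widen _ _ _ _ _ B) // (@big_nat_widenl _ _ _ _ 0) //.
  by rewrite big_mkord; apply: eq_bigl => v; rewrite /= andbC ltnS.
have -> : \det A = \det (A *m U) by rewrite det_mulmx detU mulr1.
rewrite (expand_det_row _ ord_max) big_ord_recr /= big1 ?add0r; last first.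
  by move=> j _; rewrite AUlt subrr mul0r mul0r.
rewrite AU /c /= ltnn mul0r subr0 /cofactor addnn -signr_odd odd_double mul1r.
set G := row' _ _.
have -> : G = \matrix_(i, j) ((x i - x N) * \sum_(v < B | (la j.+1 <= v <= la j)%N)
       x i ^+ (v + (N - j.+1)) * x N ^+ (la j - v)).
  apply/matrixP => i j; rewrite !mxE.
  have wE (k : 'I_N) : lift ord_max k = widen_ord (leqnSn N) k.
    by apply/val_inj; rewrite /= /bump leqNgt ltn_ord.
  by rewrite !wE; have := AUlt (widen_ord (leqnSn N) i) j; rewrite !mxE /= => ->.
rewrite (det_scale_row (fun i j : 'I_N => \sum_(v < B | (la j.+1 <= v <= la j)%N)
       x i ^+ (v + (N - j.+1)) * x N ^+ (la j - v)) (fun i : 'I_N => x i - x N)).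
rewrite mulrCA; congr (_ * _).
rewrite (det_colsum (fun (j : 'I_N) (v : 'I_B) => (la j.+1 <= v <= la j)%N)
   (fun j v i => x i ^+ (v + (N - j.+1)) * x N ^+ (la j - v))) mulr_sumr.
apply: eq_bigr => nu _.
rewrite (det_scale_col (fun i j : 'I_N => x i ^+ (nu j + (N - j.+1)))
  (fun j : 'I_N => x N ^+ (la j - nu j))) mulrCA; congr (_ * _).
  by congr (\det _); apply/matrixP => i j; rewrite !mxE /beta extE.
(* The summand j = N of the exponent is la N: it accounts for the only nonzero entry of the last
   row. *)
rewrite big_ord_recr /= ext_ge // subn0 exprD mulrC /b /beta subnn addn0; congr (_ * _).
rewrite -expr_sum; congr (_ ^+ _); apply: eq_bigr => j _; by rewrite extE.
Qed.

End Branching.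

(** * Tableaux with a filler entry and their branching rule *)

Lemma card_ord_interval B p q : (q <= B)%N ->
  #|[set j : 'I_B | (p <= j < q)%N]| = (q - p)%N.
Proof.
move=> qB; rewrite cardE -(size_map val) -[RHS](size_iota p).
apply: perm_size; apply: uniq_perm.
- by rewrite map_inj_uniq ?enum_uniq //; apply: val_inj.
- exact: iota_uniq.
move=> k; rewrite mem_iota; apply/mapP/idP => [[j + ->]|h].
  by rewrite mem_enum inE /=; lia.
have kB : (k < B)%N by lia.
by exists (Ordinal kB); rewrite // mem_enum inE /=; lia.
Qed.

(** A downward closed predicate is an initial segment, so its cardinality determines it. This
    recovers the row lengths of the small entries of a tableau. *)
Lemma card_initial B (P : pred 'I_B) :
  (forall i j : 'I_B, (i < j)%N -> P j -> P i) ->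
  forall j : 'I_B, P j = (j < #|[set i | P i]|)%N.
Proof.
move=> dP j; apply/idP/idP => [Pj|].
  rewrite -[X in (X <= _)%N]subn0 -(card_ord_interval 0 (ltn_ord j)).
  apply/subset_leq_card/subsetP => i; rewrite !inE /= ltnS leq_eqVlt.
  by case/orP=> [/eqP/val_inj->//|/dP]; apply.
apply: contraTT => nPj; rewrite -leqNgt.
rewrite -[X in (_ <= X)%N]subn0 -(card_ord_interval 0 (ltnW (ltn_ord j))).
apply/subset_leq_card/subsetP => i; rewrite !inE /= => Pi; rewrite ltnNge.
apply: contra nPj; rewrite leq_eqVlt => /orP[/eqP/val_inj->//|/dP]; exact.
Qed.

Lemma card_cells B (p q : nat -> nat) : (forall i, (q i <= B)%N) ->
  #|[set c : cell B | (p c.1 <= c.2 < q c.1)%N]| = (\sum_(i < B) (q i - p i))%N.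
Proof.
move=> qB; rewrite -sum1_card.
rewrite (eq_bigl (fun c : cell B => true && (p c.1 <= c.2 < q c.1)%N)); last first.
  by move=> c; rewrite !inE.
rewrite -(pair_big_dep xpredT (fun i j : 'I_B => (p i <= j < q i)%N) (fun _ _ => 1%N)) /=.
apply: eq_bigr => i _; rewrite -(card_ord_interval (p i) (qB i)) -sum1_card.
by apply: eq_bigl => j; rewrite inE.
Qed.

Lemma decr_eq0 la i j : decr la -> la i = 0%N -> (i <= j)%N -> la j = 0%N.
Proof. by move=> dla e /(decr_le dla); rewrite e leqn0 => /eqP. Qed.

Lemma sum_support (F : nat -> nat) m k :
  (forall i, (m <= i)%N || (k <= i)%N -> F i = 0%N) ->
  (\sum_(i < m) F i = \sum_(i < k) F i)%N.
Proof.
move=> h; wlog mk : m k h / (m <= k)%N.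
  by move=> hw; case: (leqP m k) => [/hw->|/ltnW/hw->] // i; rewrite orbC; apply: h.
rewrite (big_ord_widen _ _ mk) big_mkcond /=; apply: eq_bigr => i _.
by case: ltnP => // mi; rewrite h // mi.
Qed.

Lemma interlace_ext N B la (nu : {ffun 'I_N -> 'I_B}) :
  decr la -> la N.+1 = 0%N -> interlace la nu ->
  (forall i, (ext nu i <= la i)%N) /\ (forall i, (la i.+1 <= ext nu i)%N).
Proof.
move=> dla laN /forallP inu; split=> i; have [iN|Ni] := ltnP i N.
- by rewrite (extE nu (Ordinal iN)); have /andP[] := inu (Ordinal iN).
- by rewrite ext_ge.
- by rewrite (extE nu (Ordinal iN)); have /andP[] := inu (Ordinal iN).
- by rewrite (decr_eq0 dla laN).
Qed.

Section Tableaux.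
Variables (B : nat).

(* The cells outside the shape carry the extra entry N. *)
Definition istab N (la : nat -> nat) (f : {ffun cell B -> 'I_N.+1}) : bool :=
  [&& [forall c : cell B, (f c < N)%N == (c.2 < la c.1)%N],
      [forall c : cell B, forall d : cell B,
         (c.1 == d.1) && (c.2 < d.2)%N ==> (f c <= f d)%N]
    & [forall c : cell B, forall d : cell B,
         [&& c.2 == d.2, (c.1 < d.1)%N & (d.2 < la d.1)%N] ==> (f c < f d)%N]].

Lemma istabP N (la : nat -> nat) (f : {ffun cell B -> 'I_N.+1}) :
  reflect [/\ forall c : cell B, (f c < N)%N = (c.2 < la c.1)%N,
      forall c d : cell B, c.1 = d.1 -> (c.2 < d.2)%N -> (f c <= f d)%N
    & forall c d : cell B, c.2 = d.2 -> (c.1 < d.1)%N -> (d.2 < la d.1)%N ->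
        (f c < f d)%N]
   (istab la f).
Proof.
apply: (iffP and3P) => -[h1 h2 h3]; split.
- by move=> c; have /eqP := forallP h1 c.
- move=> c d e l; apply: (implyP (forallP (forallP h2 c) d)); by rewrite e eqxx.
- move=> c d e l l'; apply: (implyP (forallP (forallP h3 c) d)); by rewrite e eqxx l.
- by apply/forallP => c; rewrite h1.
- by apply/forallP => c; apply/forallP => d; apply/implyP => /andP[/eqP]; apply: h2.
- by apply/forallP => c; apply/forallP => d; apply/implyP => /and3P[/eqP]; apply: h3.
Qed.

(** Entries grow strictly down the column, and the top one is at least 0. *)
Lemma istab_row N (la : nat -> nat) (f : {ffun cell B -> 'I_N.+1}) (c : cell B) :
  decr la -> istab la f -> (c.2 < la c.1)%N -> (c.1 <= f c)%N.
Proof.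
move=> dla /istabP[_ _ h]; case: c => i j /=.
move Ei : (i : nat) => i'; elim: i' i Ei => [//|i' IH] i Ei.
move=> hc.
have i'B : (i' < B)%N by have := ltn_ord i; lia.
have h1 := IH (Ordinal i'B) erefl (leq_trans hc (dla i')).
apply: leq_ltn_trans h1 _; apply: h => //=; rewrite Ei //.
Qed.

Variables (K : comNzRingType) (x : nat -> K).

Definition tabsum N (la : nat -> nat) : K :=
  \sum_(f : {ffun cell B -> 'I_N.+1} | istab la f)
    \prod_(c : cell B | (c.2 < la c.1)%N) x (f c).

Lemma tabsum_eq0 N la : decr la -> (N < B)%N -> (0 < la N)%N -> tabsum N la = 0.
Proof.
move=> dla NB laN; apply: big1 => f hf; exfalso.
have B0 : (0 < B)%N by lia.
have := @istab_row N la f (Ordinal NB, Ordinal B0) dla hf laN.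
rewrite leqNgt; have /istabP[-> _ _] := hf; by rewrite laN.
Qed.

Section TabBranch.
Variables (N : nat) (la : nat -> nat).
Hypotheses (dla : decr la) (laB : (la 0 <= B)%N) (laB0 : la B = 0%N)
  (laN : la N.+1 = 0%N).

(** The shape of the entries below N. There are N+1 letters here, and the filler is N+1. A row
    length may equal B, hence the codomain ['I_B.+1]. *)
Definition tab_inner (f : {ffun cell B -> 'I_N.+2}) : {ffun 'I_N -> 'I_B.+1} :=
  [ffun j : 'I_N => if insub (j : nat) is Some i then
     inord #|[set k : 'I_B | (f (i, k) < N)%N]| else ord0].

(** Rows increase weakly, so small entries fill an initial segment of each row; from row N on there
    are none, by [istab_row]. *)
Lemma tab_inner_small f (c : cell B) : istab la f ->
  (f c < N)%N = (c.2 < ext (tab_inner f) c.1)%N.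
Proof.
move=> /[dup] hf /istabP[h1 h2 h3]; case: c => i j /=.
have [iN|Ni] := ltnP i N; last first.
  rewrite ext_ge // ltn0; apply/negbTE; rewrite -leqNgt.
  have [hc|hc] := ltnP j (la i).
    exact: leq_trans Ni (@istab_row _ la f (i, j) dla hf hc).
  by move: (h1 (i, j)); rewrite /= [(j < _)%N]ltnNge hc /=; lia.
rewrite (extE (tab_inner f) (Ordinal iN)) ffunE /= valK inordK; last first.
  by rewrite ltnS; apply: leq_trans (max_card _) _; rewrite card_ord.
apply: (@card_initial B (fun k => f (i, k) < N)%N) => k l kl; apply: leq_ltn_trans.
exact: h2.
Qed.

(** The letter N occurs at most once in a column: the cell above a cell of [la] has a smaller entry,
    hence one below N. *)
Lemma tab_inner_interlace f : istab la f -> interlace la (tab_inner f).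
Proof.
move=> /[dup] hf /istabP[h1 h2 h3]; apply/forallP => j.
have small := tab_inner_small _ hf.
rewrite -extE; set m := ext _ _.
have mB : (m <= B)%N by rewrite /m extE -ltnS.
have [jB|Bj] := ltnP j B; last first.
  have -> : la j = 0%N by apply: decr_eq0 Bj.
  have -> : la j.+1 = 0%N by apply: decr_eq0 (leqW Bj).
  by rewrite /m extE ffunE insubF // ltnNge Bj.
apply/andP; split.
  rewrite leqNgt; apply/negP => hm.
  have j1B : (j.+1 < B)%N.
    by rewrite ltnNge; apply/negP => h; move: hm; rewrite (decr_eq0 dla laB0 h).
  have m'B : (m < B)%N.
    by apply: leq_trans hm _; apply: leq_trans (decr_le dla (leq0n _)) laB.
  have := h3 (Ordinal jB, Ordinal m'B) (Ordinal j1B, Ordinal m'B) erefl (ltnSn _) hm.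
  have := small (Ordinal jB, Ordinal m'B); rewrite /= -/m ltnn => /negbT.
  rewrite -leqNgt => h4 h5.
  have := h1 (Ordinal j1B, Ordinal m'B); rewrite /= hm; lia.
rewrite leqNgt; apply/negP => hm.
have lB : (la j < B)%N by lia.
have := small (Ordinal jB, Ordinal lB); rewrite /= -/m hm => h4.
by have := h1 (Ordinal jB, Ordinal lB); rewrite /= ltnn; lia.
Qed.

(** Capping at N merges the letter N and the filler N+1 into the filler of tableaux with N letters.
    [tab_extend] separates them again by means of [la]. *)
Definition tab_restrict (f : {ffun cell B -> 'I_N.+2}) : {ffun cell B -> 'I_N.+1} :=
  [ffun c => inord (minn (f c) N)].

Definition tab_extend (g : {ffun cell B -> 'I_N.+1}) : {ffun cell B -> 'I_N.+2} :=
  [ffun c : cell B => inord (if (g c < N)%N then g c : nat else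
      if (c.2 < la c.1)%N then N else N.+1)].

Lemma tab_restrictE f c : tab_restrict f c = minn (f c) N :> nat.
Proof. by rewrite ffunE inordK // ltnS geq_minr. Qed.

Lemma tab_extendE g (c : cell B) : tab_extend g c =
  (if (g c < N)%N then g c : nat else if (c.2 < la c.1)%N then N else N.+1) :> nat.
Proof. by rewrite ffunE inordK //; case: ifP; [lia | case: ifP; lia]. Qed.

(** The counterpart of [alt_branch] for tableaux. A tableau is determined by the shape [nu] of its
    entries below N and by these entries; the cells of la/nu all carry N. *)
Lemma tabsum_branch :
  tabsum N.+1 la =
  \sum_(nu : {ffun 'I_N -> 'I_B.+1} | interlace la nu)
    tabsum N (ext nu) * x N ^+ (\sum_(j < N.+1) (la j - ext nu j)).
Proof.
rewrite /tabsum (partition_big tab_inner (interlace la)) /=; last exact: tab_inner_interlace.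
apply: eq_bigr => nu inu; rewrite mulr_suml.
have [nu_le nu_ge] := interlace_ext dla laN inu.
rewrite (reindex_onto tab_extend tab_restrict) /=; last first.
  move=> f /andP[/[dup] hf /istabP[h1 _ _] _]; apply/ffunP => c; apply/val_inj.
  rewrite /= tab_extendE tab_restrictE -(h1 c); have := ltn_ord (f c).
  by case: ifP => [|]; [lia | case: ifP; lia].
have restrictK g : tab_restrict (tab_extend g) = g.
  apply/ffunP => c; apply/val_inj; rewrite /= tab_restrictE tab_extendE.
  have := ltn_ord (g c); case: ifP => [|]; [lia | case: ifP; lia].
have condE g : [&& istab la (tab_extend g) && (tab_inner (tab_extend g) == nu)
    & tab_restrict (tab_extend g) == g] = istab (ext nu) g.
  rewrite restrictK eqxx andbT; apply/andP/idP => [[hf /eqP <-]|/istabP[g1 g2 g3]].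
    have small := tab_inner_small _ hf.
    move/istabP: (hf) => [h1 h2 h3].
    have gE c : g c = minn (tab_extend g c) N :> nat.
      by rewrite -tab_restrictE restrictK.
    apply/istabP; split=> [c|c d e l|c d e l l'].
    - by rewrite -small gE; lia.
    - by have := h2 c d e l; rewrite !gE; lia.
    - move: l'; rewrite -small => l'.
      have dla' : (d.2 < la d.1)%N by rewrite -h1; lia.
      by have := h3 c d e l dla'; rewrite !gE; lia.
  have fE := tab_extendE g.
  have ist : istab la (tab_extend g).
    apply/istabP; split=> [c|c d e l|c d e l l'].
    - rewrite fE; case: ifP => [gc|gc]; last by case: ifP; lia.
      by have := ltn_ord (g c); have := nu_le c.1; move: gc; rewrite g1; lia.
    - have h := g2 c d e l; rewrite !fE e; case: (ltnP (g c) N) => gc.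
        by case: ifP => // gd; case: ifP; lia.
      have -> : (g d < N)%N = false by rewrite ltnNge (leq_trans gc h).
      by case: (ltnP c.2 _) => hc; case: (ltnP d.2 _) => hd //; lia.
    - rewrite !fE l'; case: (ltnP (g d) N) => gd.
        rewrite g1 in gd; have := g3 c d e l gd; rewrite -g1 in gd.
        by move=> h; rewrite (ltn_trans h gd).
      have gc : (g c < N)%N.
        rewrite g1 e; apply: leq_trans l' _; apply: leq_trans (nu_ge _).
        exact: decr_le.
      by rewrite gc.
  split=> //; apply/eqP/ffunP => j; apply/val_inj; rewrite /= -!extE.
  have small (c : cell B) :
      (c.2 < ext nu c.1)%N = (c.2 < ext (tab_inner (tab_extend g)) c.1)%N.
    rewrite -g1 -tab_inner_small // fE.
    by case: ifP => // gc; case: ifP; lia.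
  have e0 (nu' : {ffun 'I_N -> 'I_B.+1}) : (ext nu' j <= B)%N by rewrite extE -ltnS.
  have [jB|Bj] := ltnP j B; last first.
    rewrite [in LHS]extE ffunE insubF ?ltnNge ?Bj //=.
    have := nu_le j; rewrite (decr_eq0 dla laB0 Bj); lia.
  have nB : (0 < B)%N by lia.
  apply/eqP; rewrite eqn_leq; apply/andP; split; rewrite leqNgt; apply/negP => h.
    have hB : (ext nu j < B)%N by have := e0 (tab_inner (tab_extend g)); lia.
    by have := small (Ordinal jB, Ordinal hB); rewrite /= h ltnn.
  have hB : (ext (tab_inner (tab_extend g)) j < B)%N by have := e0 nu; lia.
  by have := small (Ordinal jB, Ordinal hB); rewrite /= h ltnn.
rewrite (eq_bigl _ _ condE); apply: eq_bigr => g /istabP[g1 _ _].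
rewrite (bigID (fun c : cell B => (c.2 < ext nu c.1)%N)) /=; congr (_ * _).
  apply: eq_big => [c|c /andP[_ hc]]; first by have := nu_le c.1; lia.
  by rewrite tab_extendE g1 hc.
rewrite (eq_bigr (fun=> x N)); last first.
  by move=> c /andP[h1 h2]; rewrite tab_extendE g1 (negPf h2) h1.
rewrite prodr_const; congr (_ ^+ _).
have -> : #|[pred c : cell B | (c.2 < la c.1)%N & ~~ (c.2 < ext nu c.1)%N]| =
   #|[set c : cell B | (ext nu c.1 <= c.2 < la c.1)%N]|.
  by apply: eq_card => c; rewrite !inE; lia.
rewrite card_cells; last by move=> i; apply: leq_trans (decr_le dla (leq0n i)) laB.
apply: (@sum_support (fun i => la i - ext nu i)%N) => i /orP[] h.
  by rewrite (decr_eq0 dla laB0 h).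
by rewrite (decr_eq0 dla laN h).
Qed.

End TabBranch.

(** This is [alt_branch] for the empty partition, which only the zero [nu] interlaces. *)
Lemma alt_delta N :
  alt x N.+1 (fun j => N.+1 - j.+1)%N =
    \prod_(i < N) (x i - x N) * alt x N (fun j => N - j.+1)%N.
Proof.
rewrite -[LHS]/(alt x N.+1 (beta N.+1 (fun=> 0%N))) (@alt_branch K x N 1) //.
congr (_ * _); rewrite (big_pred1 [ffun=> ord0]) => [|nu].
  rewrite big1 ?expr0 ?mulr1 => [|j _]; last by rewrite sub0n.
  by congr (\det _); apply/matrixP => i j; rewrite !mxE /beta extE ffunE.
apply/forallP/eqP => [_|-> j]; last by rewrite ffunE.
by apply/ffunP => j; rewrite ffunE ord1.
Qed.

(** Removing the last variable produces the same sum over interlacing [nu] on both sides, with the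
    Vandermonde factor supplied by [alt_delta]. *)
Lemma bialternant N la : decr la -> (la 0 <= B)%N -> la B = 0%N -> la N = 0%N ->
  alt x N (beta N la) = alt x N (fun j => N - j.+1)%N * tabsum N la.
Proof.
elim: N la => [|N IH] la dla laB laB0 laN.
  have la0 i : la i = 0%N by apply: decr_eq0 laN _.
  rewrite /alt !det_mx00 mul1r /tabsum.
  rewrite (eq_bigl (pred1 [ffun=> ord0])) ?big_pred1_eq => [|f]; last first.
    apply/idP/eqP => [_|_]; first by apply/ffunP => c; rewrite ffunE ord1.
    apply/istabP; split=> [c|c d|c d].
    - by rewrite la0.
    - by rewrite !ord1.
    - by rewrite la0.
  by rewrite big1 // => c; rewrite la0.
rewrite (@alt_branch K x N B.+1 la) // alt_delta -mulrA; congr (_ * _).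
rewrite tabsum_branch // mulr_sumr; apply: eq_bigr => nu inu.
have [nu_le nu_ge] := interlace_ext dla laN inu.
rewrite IH ?mulrA //.
- by move=> i; apply: leq_trans (nu_le _) (nu_ge _).
- exact: leq_trans (nu_le 0%N) laB.
- by apply/eqP; rewrite -leqn0 -laB0.
- by rewrite ext_ge.
Qed.

End Tableaux.

(** Variables indexed by natural numbers, as [alt] and [hsum] expect them; this serves both for the
    x_i and for the t_d. *)
Definition mvar (R : comNzRingType) N (i : nat) : {mpoly R[N]} :=
  if insub i is Some j then 'X_j else 0.

Lemma mvarE (R : comNzRingType) N (j : 'I_N) : mvar R N j = 'X_j.
Proof. by rewrite /mvar valK. Qed.

Section SchurTableaux.
Variables (R : comNzRingType) (N : nat) (la : seq nat).
Hypothesis dla : decr (nth 0%N la).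
Let B := sumn la.

Definition tab_of_ssyt (t : {ffun cell_of la -> 'I_N}) : {ffun cell B -> 'I_N.+1} :=
  [ffun c : cell B => if insub c is Some c' then widen_ord (leqnSn N) (t c')
                      else ord_max].

Lemma tab_of_ssytE t (c : cell_of la) : tab_of_ssyt t (val c) = t c :> nat.
Proof. by rewrite ffunE valK. Qed.

Lemma tab_of_ssyt_inj : injective tab_of_ssyt.
Proof.
move=> t u e; apply/ffunP => c; apply/val_inj.
by rewrite /= -!tab_of_ssytE e.
Qed.

Lemma cell_ofP (c : cell B) : (c.2 < nth 0 la c.1)%N ->
  exists c' : cell_of la, val c' = c.
Proof.
move=> h; have hc : c \in young (sumn la) la by rewrite inE.
by exists (Sub c hc); rewrite SubK.
Qed.

Lemma cell_ofT (c : cell_of la) : ((val c).2 < nth 0 la (val c).1)%N.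
Proof. by have := valP c; rewrite inE. Qed.

Lemma tab_of_ssyt_image :
  tab_of_ssyt @: [set t | is_ssyt t] = [set f | istab (nth 0%N la) f].
Proof.
apply/setP => f; rewrite inE; apply/imsetP/istabP => [[t + ->]|[h1 h2 h3]].
  rewrite inE => /forallP ht.
  have out (c : cell B) : ~~ (c.2 < nth 0 la c.1)%N -> tab_of_ssyt t c = N :> nat.
    by move=> h; rewrite ffunE insubF //= inE; apply/negbTE.
  split=> [c|c d e l|c d e l l'].
  - have [h|h] := boolP (c.2 < nth 0 la c.1)%N; last by rewrite out // ltnn.
    by have [c' <-] := cell_ofP h; rewrite tab_of_ssytE ltn_ord.
  - have [h|h] := boolP (d.2 < nth 0 la d.1)%N; last first.
      by rewrite (out d) // -ltnS ltn_ord.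
    have h' : (c.2 < nth 0 la c.1)%N by rewrite e; lia.
    have [c' ec] := cell_ofP h'; have [d' ed] := cell_ofP h.
    have /forallP/(_ d')/andP[/implyP hh _] := ht c'.
    by rewrite -ec -ed !tab_of_ssytE; apply: hh; rewrite ec ed e eqxx.
  - have [d' ed] := cell_ofP l'.
    have h : (c.2 < nth 0 la c.1)%N.
      by rewrite e; apply: leq_trans l' _; apply: decr_le (ltnW l).
    have [c' ec] := cell_ofP h.
    have /forallP/(_ d')/andP[_ /implyP hh] := ht c'.
    by rewrite -ec -ed !tab_of_ssytE; apply: hh; rewrite ec ed e eqxx.
have [t ht] : exists t : cell_of la -> 'I_N, forall c, t c = f (val c) :> nat.
  apply: (@fin_all_exists _ (fun=> 'I_N) (fun c i => i = f (val c) :> nat)) => c.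
  have fc : (f (val c) < N)%N by rewrite h1 cell_ofT.
  by exists (Ordinal fc).
exists (finfun t).
  rewrite inE; apply/forallP => c; apply/forallP => d; rewrite !ffunE !ht.
  apply/andP; split; apply/implyP => /andP[/eqP e l]; first exact: h2.
  by apply: h3 => //; apply: cell_ofT.
apply/ffunP => c; apply/val_inj; rewrite /= ffunE.
case: insubP => [c' _ <-|]; first by rewrite /= ffunE ht.
rewrite inE -h1 -leqNgt /= => h; apply/eqP; rewrite eqn_leq h andbT.
by rewrite -ltnS ltn_ord.
Qed.

Lemma schur_tabsum : schur R N la = tabsum B (mvar R N) N (nth 0%N la).
Proof.
rewrite /tabsum -(eq_bigl _ _ (fun f => in_set (fun f => istab (nth 0%N la) f) f)).
rewrite -tab_of_ssyt_image big_imset /=; last by move=> t u _ _; apply: tab_of_ssyt_inj.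
rewrite /schur; apply: eq_big => [t|t _]; first by rewrite inE.
rewrite (eq_bigl (fun c => c \in young B la)); last by move=> c; rewrite inE.
rewrite (big_sub (young B la)); apply: eq_bigr => c _.
by rewrite tab_of_ssytE mvarE.
Qed.

End SchurTableaux.

(** The number M of variables that occur is separated from N, so that the recursion [alt_delta]
    descends inside a fixed ring. *)
Lemma alt_delta_neq0 (R : idomainType) N M : (M <= N)%N ->
  alt (mvar R N) M (fun j => M - j.+1)%N != 0.
Proof.
elim: M => [|M IH] MN; first by rewrite /alt det_mx00 oner_neq0.
rewrite alt_delta mulf_neq0 ?IH ?(ltnW MN) //.
apply/prodf_neq0 => i _; have iN : (i < N)%N by apply: ltn_trans MN.
rewrite (mvarE R (Ordinal iN)) (mvarE R (Ordinal MN)) subr_eq0.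
apply/eqP => /(congr1 (mcoeff U_(Ordinal iN)%MM)).
rewrite !mcoeffXU eqxx; case: eqP => [[] e|_ /eqP]; last by rewrite oner_eq0.
by have := ltn_ord i; rewrite -e ltnn.
Qed.

Lemma part_decr la : is_part la -> decr (nth 0%N la).
Proof.
move=> /andP[/(sortedP 0%N) sla _] i; have [h|h] := ltnP i.+1 (size la).
  exact: sla.
by rewrite nth_default.
Qed.

Lemma nth_le_sumn (la : seq nat) i : (nth 0 la i <= sumn la)%N.
Proof.
elim: la i => [|a la IH] i; first by rewrite nth_nil.
by case: i => [|i] /=; [lia | have := IH i; lia].
Qed.

Lemma part_size la : is_part la -> (size la <= sumn la)%N.
Proof.
case/andP=> _; elim: la => [//|a la IH] /=; rewrite inE negb_or => /andP[a0 /IH]; lia.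
Qed.

Lemma schur_alt (R : comNzRingType) N la : is_part la -> (size la <= N)%N ->
  alt (mvar R N) N (beta N (nth 0%N la)) =
    alt (mvar R N) N (fun j => N - j.+1)%N * schur R N la.
Proof.
move=> pla sN; have dla := part_decr pla; rewrite schur_tabsum //.
apply: bialternant => //; first exact: nth_le_sumn.
  by rewrite nth_default ?part_size.
by rewrite nth_default.
Qed.

Lemma schur_eq0 (R : comNzRingType) N la : is_part la -> (N < size la)%N ->
  schur R N la = 0.
Proof.
move=> pla Ns; have dla := part_decr pla; rewrite schur_tabsum //.
apply: tabsum_eq0 => //; first exact: leq_trans (part_size pla).
by case/andP: pla => _ n0; rewrite lt0n; apply: contra n0 => /eqP <-; apply: mem_nth.
Qed.

(** * Ribbons and monotonic tilings *)

Section Profile.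
Implicit Types la rho : nat -> nat.

(* Rows a..r of rho/la form a ribbon: each row below the first one overlaps the
   row above it in exactly one column. *)
Definition profile la rho a r : Prop :=
  [/\ (a <= r)%N, forall i, (i < a)%N || (r < i)%N -> rho i = la i,
      (la a < rho a)%N
    & forall i, (a < i <= r)%N -> rho i = (la i.-1).+1].

Lemma profile_row la rho a r i : decr la -> profile la rho a r ->
  (la i < rho i)%N = (a <= i <= r)%N.
Proof.
move=> dla [ar h1 h2 h3]; have [h|h] := boolP (a <= i <= r)%N; last first.
  by rewrite h1 ?ltnn //; lia.
have [->//|ne] := eqVneq i a; rewrite h3; last by lia.
by rewrite ltnS; apply: decr_le => //; lia.
Qed.

(** In the rows below a, the lengths la (i-1) + 1 - la i telescope. *)
Lemma profile_sum la rho a r M : decr la -> profile la rho a r -> (r < M)%N ->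
  (\sum_(i < M) (rho i - la i) + la r = rho a + (r - a))%N.
Proof.
move=> dla p rM; have [ar h1 h2 h3] := p.
have A m : (m <= a)%N -> (\sum_(i < m) (rho i - la i) = 0)%N.
  by move=> ma; rewrite big1 // => i _; rewrite h1 ?subnn //; have := ltn_ord i; lia.
have C m : (a <= m <= r)%N ->
    (\sum_(i < m.+1) (rho i - la i) + la m = rho a + (m - a))%N.
  elim: m => [|m IH] am.
    by have e : a = 0%N by [lia]; rewrite big_ord_recr big_ord0 /= e in h2 *; lia.
  have [e|ne] := eqVneq a m.+1.
    by rewrite big_ord_recr /= A -?e //; lia.
  rewrite big_ord_recr /= h3; last lia.
  by have := IH ltac:(lia); have := dla m; rewrite /=; lia.
elim: M rM => [//|M IH]; rewrite ltnS leq_eqVlt => /orP[/eqP <-|rM].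
  by apply: C; rewrite ar leqnn.
by rewrite big_ord_recr /= h1 ?rM ?orbT // subnn addn0 IH.
Qed.

Lemma step_profile la r d : decr la -> step_ok la r d -> (0 < d)%N ->
  profile la (step la r d) (step_row la r d) r.
Proof.
move=> dla ok d0; have ar := step_row_le la r d.
have hlt := @step_row_lt la r d dla _ ar; rewrite ltnn in hlt.
rewrite /step; split=> // [i ->//||i ir].
  have -> : ((step_row la r d < step_row la r d) || (r < step_row la r d))%N = false by lia.
  rewrite eqxx.
  have := @step_okP la r d (step_row la r d) ok.
  by have [e|ne] := eqVneq (step_row la r d) r; [rewrite e; lia | lia].
have -> : ((i < step_row la r d) || (r < i))%N = false by lia.
by have -> : (i == step_row la r d) = false by [lia].
Qed.

(** A ribbon is recovered from its tail row and size: the equation says that the moved bead lands on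
    the position of rho in row a. Since [rho] decreases, the beads above row a lie beyond this
    position. *)
Lemma profile_step la rho a r d : decr la -> decr rho -> profile la rho a r ->
  (d + la r = rho a + (r - a))%N ->
  [/\ step_ok la r d, step_row la r d = a & step la r d =1 rho].
Proof.
move=> dla drho p e; have [ar h1 h2 h3] := p.
have lt i : (i < a)%N -> (la r + d + i < la i + r)%N.
  by move=> ia; have := decr_le drho (ltnW ia); rewrite (h1 i) ?ia //; lia.
have gt i : (a <= i <= r)%N -> (la i + r < la r + d + i)%N.
  by move=> /andP[ai ir]; have := decr_le dla ai; lia.
have ok : step_ok la r d.
  apply/allP => i; rewrite mem_iota /= => ir; apply/eqP => h.
  by have [/lt|ai] := ltnP i a; [lia | have := gt i; lia].
have ra : step_row la r d = a.
  have sr := step_row_le la r d; apply/eqP; rewrite eqn_leq; apply/andP; split.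
    rewrite leqNgt; have := @step_row_lt la r d dla a ar; have := gt a; lia.
  rewrite leqNgt; apply/negP => h; have := @step_row_lt la r d dla _ sr.
  by rewrite ltnn lt.
split=> // i; rewrite /step ra; case: ifP => [/h1//|hi].
by case: eqP => [->|ne]; [lia | rewrite h3 //; lia].
Qed.

End Profile.

(** * Ribbons as differences of two row functions *)

Section Geometry.
Variable n : nat.
Implicit Types (la rho : nat -> nat) (D xi : {set cell n}).

Definition yset la : {set cell n} := [set c : cell n | (c.2 < la c.1)%N].

(** The diagram lies in the n x n box, so that [yset] loses none of its cells. *)
Definition fits la : Prop := [/\ decr la, (la 0 <= n)%N & la n = 0%N].

Lemma fits_le la i : fits la -> (la i <= n)%N.
Proof. by move=> [dla h _]; apply: leq_trans (decr_le dla (leq0n i)) h. Qed.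

Lemma card_yset_row la (i : 'I_n) : fits la ->
  #|[set j : 'I_n | (i, j) \in yset la]| = la i.
Proof.
move=> fla; rewrite -[RHS]subn0 -(card_ord_interval 0 (fits_le i fla)).
by apply: eq_card => j; rewrite !inE.
Qed.

Lemma eq_fits la rho : la =1 rho -> fits la -> fits rho.
Proof. by move=> e [h1 h2 h3]; split; rewrite -?e // => i; rewrite -!e. Qed.

Lemma sorted_filter_nth (s : seq nat) i : sorted geq s ->
  nth 0%N [seq l <- s | l != 0%N] i = nth 0%N s i.
Proof.
elim: s i => [//|a s IH] i /= ps.
have [a0|a0] /= := eqVneq a 0%N; last by case: i => [|i] //=; apply/IH/(path_sorted ps).
have s0 : all (pred1 0%N) s.
  have tr : transitive geq by move=> x y z h1 h2; apply: leq_trans h2 h1.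
  move: (order_path_min tr ps); apply: sub_all => b /=.
  by rewrite a0 /geq /= leqn0.
have -> : [seq l <- s | l != 0%N] = [::].
  by elim: s s0 {IH ps} => //= b s IH /andP[/eqP -> /IH].
rewrite nth_nil a0; case: i => [//|i] /=.
have [h|h] := ltnP i (size s); last by rewrite nth_default.
by have /eqP -> := all_nthP 0%N s0 i h.
Qed.

Lemma shape_yset la : fits la ->
  is_part (shape_of (yset la)) /\ nth 0%N (shape_of (yset la)) =1 la.
Proof.
move=> fla; have [dla la0 lan] := fla.
have rE : row_lengths (yset la) = map la (iota 0 n).
  rewrite /row_lengths -val_enum_ord -map_comp; apply: eq_map => i /=.
  exact: card_yset_row.
have sr : sorted geq (row_lengths (yset la)).
  rewrite rE; apply/(sortedP 0%N) => i; rewrite size_map size_iota => h.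
  by rewrite !(nth_map 0%N) ?size_iota ?nth_iota //; first exact: dla; lia.
split.
  rewrite /is_part /shape_of sorted_filter //=.
    by rewrite mem_filter eqxx.
  by move=> x y z h1 h2; apply: leq_trans h2 h1.
move=> i; rewrite /shape_of sorted_filter_nth // rE.
have [h|h] := ltnP i n; first by rewrite (nth_map 0%N) ?size_iota ?nth_iota.
by rewrite nth_default ?size_map ?size_iota // (decr_eq0 dla lan h).
Qed.

Lemma is_youngP D : is_young D <-> exists2 la, fits la & D = yset la.
Proof.
split=> [/andP[ps /eqP e]|[la fla ->]].
  exists (nth 0%N (shape_of D)); last exact: e.
  have sz : (size (shape_of D) <= n)%N.
    rewrite /shape_of size_filter; apply: leq_trans (count_size _ _) _.
    by rewrite /row_lengths size_map size_enum_ord.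
  split; [exact: part_decr| |by rewrite nth_default].
  have [s0|s0] := posnP (size (shape_of D)); first by rewrite nth_default ?s0.
  have := mem_nth 0%N s0; rewrite mem_filter => /andP[_ /mapP[i _ ->]].
  by apply: leq_trans (max_card _) _; rewrite card_ord.
have [h1 h2] := shape_yset fla; rewrite /is_young h1 /=.
by apply/eqP/setP => c; rewrite !inE h2.
Qed.

(** If row n were not empty, there would be at least n+1 cells. *)
Lemma fits_sum la M : decr la -> la M = 0%N -> (\sum_(i < M) la i <= n)%N -> fits la.
Proof.
move=> dla laM s; split=> //.
  case: M laM s => [->//|M] _; rewrite big_ord_recl; apply: leq_trans.
  exact: leq_addr.
have [h|h] := leqP M n; first exact: decr_eq0 h.
apply/eqP; rewrite -leqn0 leqNgt; apply/negP => lan.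
have : (\sum_(i < n.+1) 1 <= \sum_(i < M) la i)%N.
  rewrite (big_ord_widen _ (fun=> 1%N) h) big_mkcond /=; apply: leq_sum => i _.
  case: ifP => // hi; apply: leq_trans lan _; exact: decr_le.
by rewrite sum1_card card_ord => /leq_trans/(_ s); rewrite ltnn.
Qed.

Section Ribbon.
Variables (la rho : nat -> nat).
Hypotheses (fla : fits la) (frho : fits rho).
Let xi := yset rho :\: yset la.

Let xiE (c : cell n) : (c \in xi) = (la c.1 <= c.2 < rho c.1)%N.
Proof. by rewrite !inE; lia. Qed.

Lemma card_ribbon : #|xi| = (\sum_(i < n) (rho i - la i))%N.
Proof.
rewrite -card_cells; last by move=> i; apply: fits_le.
by apply: eq_card => c; rewrite xiE inE.
Qed.

Section FromProfile.
Variables (a r : nat).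
Hypothesis p : profile la rho a r.

Let dla : decr la. Proof. by case: fla. Qed.

Lemma profile_lt : (r < n)%N.
Proof.
have h : (la r < rho r)%N by rewrite (profile_row _ dla p); case: p => ->; rewrite leqnn.
rewrite ltnNge; apply/negP => nr; case: frho => [d _ e].
by rewrite (decr_eq0 d e nr) in h.
Qed.

Lemma profile_col : (la r < n)%N.
Proof.
have h : (la r < rho r)%N by rewrite (profile_row _ dla p); case: p => ->; rewrite leqnn.
by have := fits_le r frho; lia.
Qed.

Let c0 : cell n := (Ordinal profile_lt, Ordinal profile_col).

Let c0xi : c0 \in xi.
Proof. by rewrite xiE /= leqnn (profile_row _ dla p); case: p => ->; rewrite leqnn. Qed.

Let xi_rows (c : cell n) : c \in xi -> (a <= c.1 <= r)%N /\ (la r <= c.2)%N.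
Proof.
rewrite xiE => /andP[h1 h2]; have h : (a <= c.1 <= r)%N.
  by rewrite -(profile_row _ dla p); apply: leq_ltn_trans h1 h2.
by split=> //; apply: leq_trans h1; apply: decr_le => //; case/andP: h.
Qed.

(** The cell (r, la r) is southwest of all others. The second equation concerns the row of the tail,
    later named [tail_row]. *)
Lemma profile_tail : tail_column xi = la r /\
  (if [pick c in xi | [forall d in xi, (d.1 <= c.1)%N && (c.2 <= d.2)%N]] is Some c
   then c.1 : nat else 0%N) = r.
Proof.
rewrite /tail_column; case: pickP => [c /andP[cxi /forall_inP hc]|/(_ c0)].
  have := hc c0 c0xi; have [] := xi_rows cxi; rewrite /= => h1 h2 h3; lia.
rewrite c0xi /= => /negP[]; apply/forall_inP => d /xi_rows /=; lia.
Qed.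

Lemma profile_height : height xi = (r - a)%N.
Proof.
rewrite /height.
have -> : [set c.1 | c in xi] = [set i : 'I_n | (a <= i < r.+1)%N].
  apply/setP => i; rewrite inE ltnS -(profile_row _ dla p).
  apply/imsetP/idP => [[c + ->]|h].
    by rewrite xiE => /andP[]; apply: leq_ltn_trans.
  have lin : (la i < n)%N by have := fits_le i frho; lia.
  by exists (i, Ordinal lin); rewrite // xiE /= leqnn.
by rewrite card_ord_interval ?profile_lt //; case: p; lia.
Qed.

Lemma profile_ribbon : is_ribbon xi.
Proof.
have [ar h1 h2 h3] := p.
apply/and4P; split.
- by apply/set0Pn; exists c0.
- apply/existsP; exists (yset rho); apply/existsP; exists (yset la).
  rewrite eqxx andbT; apply/and3P; split.
  + by apply/is_youngP; exists rho.
  + by apply/is_youngP; exists la.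
  apply/subsetP => -[i j]; rewrite !inE /=; suff : (la i <= rho i)%N by lia.
  have [h|h] := boolP (a <= i <= r)%N; last by rewrite h1 //; lia.
  by apply: ltnW; rewrite (profile_row _ dla p).
- pose e : rel (cell n) := [rel u v | [&& u \in xi, v \in xi & adjacent u v]].
  have esym : ssrbool.symmetric e.
    move=> u v; rewrite /e /= andbCA; congr [&& _, _ & _].
    rewrite /adjacent [u.1 == _]eq_sym [u.2 == _]eq_sym.
    by congr (_ && _ || _ && _); rewrite orbC.
  have is_c0 (i j : 'I_n) : (i : nat) = r -> (j : nat) = la r -> (i, j) = c0.
    by move=> ei ej; congr (_, _); apply/val_inj.
  (* From any cell one walks left to the start of the row, then down: the first cell of row i lies
     above the last cell of row i+1. Each move lowers r - i + j. *)
  have toc0 (i j : 'I_n) : (i, j) \in xi -> connect e (i, j) c0.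
    move Em : (r - i + j)%N => m; elim: m i j Em => [|m IH] i j Em cxi.
      have [/= ? ?] := xi_rows cxi.
      by rewrite (is_c0 i j); [exact: connect0 | lia | lia].
    have [/= hr hl] := xi_rows cxi; have := cxi; rewrite xiE /= => /andP[g1 g2].
    have [eq|ne] := eqVneq (j : nat) (la i).
      have [er|nr] := eqVneq (i : nat) r.
        by rewrite (is_c0 i j) -?er //; exact: connect0.
      have i1 : (i.+1 < n)%N by have := profile_lt; lia.
      have c'xi : (Ordinal i1, j) \in xi.
        rewrite xiE /= h3; last lia.
        by rewrite /= eq ltnS leqnn andbT; apply: dla.
      apply: (@connect_trans _ _ (Ordinal i1, j)).
        by apply: connect1; rewrite /e /= cxi c'xi /adjacent /= !eqxx orbT.
      by apply: IH => //=; lia.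
    have j1 : (j.-1 < n)%N by have := ltn_ord j; lia.
    have c'xi : (i, Ordinal j1) \in xi by rewrite xiE /=; lia.
    apply: (@connect_trans _ _ (i, Ordinal j1)).
      apply: connect1; rewrite /e /= cxi c'xi /adjacent /= eqxx /=.
      by have -> : (j == j.-1.+1 :> nat) by [lia]; rewrite orbT.
    by apply: IH => //=; lia.
  apply/forall_inP => -[i j] cxi; apply/forall_inP => -[i' j'] dxi.
  apply: connect_trans (toc0 _ _ cxi) _.
  by rewrite -/e (sym_connect_sym esym); apply: toc0.
(* A square would need two columns common to rows i and i+1. *)
- apply/negP => /exists_inP[[i j] cxi /exists_inP[[i' j'] dxi]].
  move=> /and4P[/eqP/= e1 /eqP/= e2 _ _].
  have [/= c1 c2] := xi_rows cxi; have [/= d1 d2] := xi_rows dxi.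
  move: cxi dxi; rewrite !xiE /= e1 e2.
  by have := h3 i.+1; rewrite /=; lia.
Qed.

End FromProfile.

(** Let a and r be the first and last rows met, and a < i <= r. If rho i > la (i-1) + 1, rows i-1
    and i share two columns and contain a square. If rho i is smaller, they share no column, so no
    edge joins them and the ribbon is disconnected. *)
Lemma ribbon_profile : (forall i, la i <= rho i)%N -> is_ribbon xi ->
  exists a r, profile la rho a r.
Proof.
move=> le /and4P[/set0Pn[c cxi] _ /forall_inP con nsq].
have [dla la0 lan] := fla; have [drho rho0 rhon] := frho.
have bnd i : (la i < rho i)%N -> (i <= n)%N.
  by move=> h; rewrite leqNgt; apply/negP => /ltnW nh; rewrite (decr_eq0 drho rhon nh) in h.
have ex : exists i, (la i < rho i)%N.
  by exists c.1; move: cxi; rewrite xiE => /andP[]; apply: leq_ltn_trans.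
case: (ex_minnP ex) => a la_a mina; case: (ex_maxnP ex bnd) => r la_r maxr.
exists a, r.
have rown i : (la i < rho i)%N -> (i < n)%N.
  by move=> h; rewrite ltnNge; apply/negP => nh; rewrite (decr_eq0 drho rhon nh) in h.
have coln i : (la i < rho i)%N -> (la i < n)%N by have := fits_le i frho; lia.
split=> [|i h||i /andP[ai ir]]; first exact: mina.
- apply/eqP; rewrite eqn_leq le andbT leqNgt; apply/negP => hi.
  by have := mina i hi; have := maxr i hi; lia.
- by [].
have i0 : (0 < i)%N by lia.
have iE : i.-1.+1 = i by lia.
have iN : (i < n)%N by have := rown r la_r; lia.
have iN' : (i.-1 < n)%N by lia.
apply/eqP; rewrite eqn_leq; apply/andP; split; rewrite leqNgt; apply/negP => h.
  have j1 : ((la i.-1).+1 < n)%N by have := fits_le i frho; lia.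
  have j0 : (la i.-1 < n)%N by lia.
  have hd : (la i <= la i.-1)%N by apply: decr_le => //; lia.
  have hr : (rho i <= rho i.-1)%N by apply: decr_le => //; lia.
  move/negP: nsq; apply; apply/exists_inP.
  exists (Ordinal iN', Ordinal j0); first by rewrite xiE /=; lia.
  apply/exists_inP; exists (Ordinal iN, Ordinal j1); first by rewrite xiE /=; lia.
  by rewrite !xiE /= iE !eqxx /=; lia.
have ca : (Ordinal (rown a la_a), Ordinal (coln a la_a)) \in xi by rewrite xiE /= leqnn.
have cr : (Ordinal (rown r la_r), Ordinal (coln r la_r)) \in xi by rewrite xiE /= leqnn.
have := forall_inP (con _ ca) _ cr.
pose e : rel (cell n) := [rel u v | [&& u \in xi, v \in xi & adjacent u v]].
(* The cells above row i form a union of components, which contains a cell of row a but none of row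
   r. *)
rewrite -/e => /(@closed_connect _ e [pred c : cell n | (c.1 < i)%N]).
rewrite !inE /=; have -> : (a < i)%N by [].
have -> : (r < i)%N = false by lia.
move=> hh; suff: true = false by [].
apply: hh => -[u1 u2] [v1 v2]; rewrite /e /= => /and3P[+ + adj]; rewrite !xiE !inE /= => hu hv.
move: adj; rewrite /adjacent /= => /orP[/andP[/eqP -> _]//|/andP[/eqP e2 e1]].
rewrite e2 in hu.
have [ui|ui] := ltnP u1 i; have [vi|vi] := ltnP v1 i; rewrite ?ui ?vi //; exfalso.
  have eu : u1 = i.-1 :> nat by lia.
  have ev : v1 = i :> nat by lia.
  by rewrite eu in hu; rewrite ev in hv; lia.
have eu : v1 = i.-1 :> nat by lia.
have ev : u1 = i :> nat by lia.
by rewrite eu in hv; rewrite ev in hu; lia.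
Qed.

End Ribbon.

End Geometry.

(** * Tilings as sequences of bead moves *)

Section Tilings.
Variable n : nat.
Implicit Types (la rho : nat -> nat) (D xi : {set cell n}) (T : seq {set cell n}).

Definition tail_row D : nat :=
  if [pick c in D | [forall d in D, (d.1 <= c.1)%N && (c.2 <= d.2)%N]] is Some c
  then c.1 : nat else 0%N.

Definition head_row_lt T R : bool :=
  if T is xi :: _ then (tail_row xi < R)%N else true.

(** The tiling conditions one tile at a time, with [D] the part already covered; in this form tiles
    and moves are compared by induction. *)
Fixpoint tiles_from D T : bool :=
  if T is xi :: T' then
    [&& is_ribbon xi, [disjoint xi & D], is_young (D :|: xi)
      & tiles_from (D :|: xi) T']
  else true.

Lemma tile_union_cons xi T : tile_union (xi :: T) = xi :|: tile_union T.
Proof. by rewrite /tile_union big_cons. Qed.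

Lemma tiles_fromE D T : is_young D ->
  tiles_from D T =
  [&& all (@is_ribbon n) T, all (fun xi => [disjoint xi & D]) T,
      pairwise (fun xi zeta : {set cell n} => [disjoint xi & zeta]) T
    & all (fun i => is_young (D :|: tile_union (take i T))) (iota 0 (size T).+1)].
Proof.
elim: T D => [|xi T IH] D yD.
  by rewrite /= /tile_union big_nil setU0 yD.
have disjU (zeta : {set cell n}) :
    [disjoint zeta & D :|: xi] = [disjoint zeta & D] && [disjoint xi & zeta].
  by rewrite -!setI_eq0 setIUr setU_eq0 [xi :&: _]setIC.
have iotaE m : iota 1 m = map succn (iota 0 m) by rewrite -[1%N]addn0 iotaDl.
have takeE : all (fun i => is_young (D :|: tile_union (take i (xi :: T)))) (iota 0 (size T).+2)
   = all (fun i => is_young (D :|: xi :|: tile_union (take i T))) (iota 0 (size T).+1).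
  have -> : iota 0 (size T).+2 = 0%N :: iota 1 (size T).+1 by [].
  rewrite iotaE [LHS]/= all_map {1}/tile_union big_nil setU0 yD /=.
  by congr (_ && _); [|apply: eq_all => i] => /=; rewrite ?take0 /= tile_union_cons setUA.
have youngE : tiles_from D (xi :: T) =
  [&& is_ribbon xi, [disjoint xi & D], is_young (D :|: xi) &
  [&& all (@is_ribbon n) T, all (fun zeta : {set cell n} => [disjoint zeta & D :|: xi]) T,
      pairwise (fun xi zeta : {set cell n} => [disjoint xi & zeta]) T
    & all (fun i => is_young (D :|: xi :|: tile_union (take i T))) (iota 0 (size T).+1)]].
  rewrite /=; case: (boolP (is_young _)) => [h|]; last by rewrite !andbF.
  by rewrite IH.
have allU : all (fun zeta : {set cell n} => [disjoint zeta & D :|: xi]) T =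
    all (fun zeta : {set cell n} => [disjoint zeta & D]) T &&
    all (fun zeta : {set cell n} => [disjoint xi & zeta]) T.
  by rewrite (eq_all disjU) -all_predI.
rewrite youngE takeE allU.
set A := all _ (iota _ _).
have hA : A -> is_young (D :|: xi).
  by move=> /andP[+ _]; rewrite take0 /tile_union big_nil setU0.
rewrite /=; case: (boolP A) => [/hA ->|_]; rewrite ?andbT ?andbF //=.
case: (is_ribbon xi) => //=; case: [disjoint xi & D] => //=; rewrite ?andbF //.
by case: (all (@is_ribbon n) T); case: (all _ T); case: (all _ T) => //=; rewrite ?andbF.
Qed.

Lemma mono_tilingE T : is_mono_ribbon_tiling T =
  tiles_from set0 T && sorted ltn [seq tail_column xi | xi : {set cell n} <- T].
Proof.
have y0 : is_young (set0 : {set cell n}).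
  apply/is_youngP; exists (fun=> 0%N); first by split.
  by apply/setP => c; rewrite !inE.
rewrite tiles_fromE // /is_mono_ribbon_tiling.
have -> : all (fun xi : {set cell n} => [disjoint xi & set0]) T.
  by apply/allP => xi _; rewrite -setI_eq0 setI0.
have -> : all (fun i => is_young (set0 :|: tile_union (take i T))) (iota 0 (size T).+1) =
    all (fun i => is_young (tile_union (take i T))) (iota 0 (size T).+1).
  by apply: eq_all => i; rewrite set0U.
case: (sorted _ _); rewrite ?andbT ?andbF //.
Qed.

Definition tile_moves T : seq (nat * nat) := [seq (tail_row xi, #|xi|) | xi <- T].

Fixpoint tiles_of la (s : seq (nat * nat)) : seq {set cell n} :=
  if s is m :: s' then
    (yset n (step la m.1 m.2) :\: yset n la) :: tiles_of (step la m.1 m.2) s'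
  else [::].

(** The union is the diagram of some rho, so the tile is rho/la; [ribbon_profile] describes its
    rows, and [profile_step] reads this as a bead move. *)
Lemma tile_step la xi : fits n la -> is_ribbon xi -> [disjoint xi & yset n la] ->
  is_young (yset n la :|: xi) ->
  let r := tail_row xi in let d := #|xi| in
  [/\ [/\ step_ok la r d, (0 < d)%N & fits n (step la r d)],
      [/\ yset n la :|: xi = yset n (step la r d),
      xi = yset n (step la r d) :\: yset n la
    & height xi = (r - step_row la r d)%N]
    & tail_column xi = la r /\ (la r < step la r d r)%N].
Proof.
move=> fla rib dis /is_youngP[rho frho eU] r d.
have xiE : xi = yset n rho :\: yset n la.
  apply/setP => c; rewrite -eU !inE; have [cx|//] := boolP (c \in xi).
    by have := disjointFr dis cx; rewrite inE => ->; rewrite orbT.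
  by rewrite orbF andNb.
have le i : (la i <= rho i)%N.
  have [iN|nN] := ltnP i n; last by case: fla => [dla _ e]; rewrite (decr_eq0 dla e).
  rewrite leqNgt; apply/negP => h.
  have jN : (rho i < n)%N by have := fits_le i fla; lia.
  by have /setP/(_ (Ordinal iN, Ordinal jN)) := eU; rewrite !inE /= h ltnn.
have [dla la0 lan] := fla; have [drho _ _] := frho.
move: (rib); rewrite {1}xiE => /(ribbon_profile fla frho le)[a [r' p]].
have [tc tr] := profile_tail fla frho p; rewrite -xiE in tc tr.
have er : r = r' by rewrite /r /tail_row tr.
rewrite -er in p tc; have rn := profile_lt fla frho p.
have dE : (d + la r = rho a + (r - a))%N.
  by rewrite /d xiE card_ribbon // (profile_sum dla p rn).
have [ok sr srho] := profile_step dla drho p dE.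
have yE : yset n (step la r d) = yset n rho.
  by apply/setP => c; rewrite !inE srho.
have ht := profile_height fla frho p; rewrite -xiE in ht.
have lar : (la r < rho r)%N.
  by rewrite (profile_row _ dla p); case: p => ->; rewrite leqnn.
split; [split=> //|split|split=> //].
- by have [ar _ ? _] := p; have := decr_le dla ar; lia.
- by apply: eq_fits frho => i; rewrite srho.
- by rewrite yE.
- by rewrite yE.
- by rewrite ht sr.
- by rewrite srho.
Qed.

Lemma tiles_to_moves la T R : fits n la -> tiles_from (yset n la) T ->
  sorted ltn [seq tail_column xi | xi : {set cell n} <- T] ->
  head_row_lt T R ->
  [/\ mvalid la R (tile_moves T), all (fun m => (0 < m.2)%N) (tile_moves T),
      tiles_of la (tile_moves T) = T,
      yset n la :|: tile_union T = yset n (mfinal la (tile_moves T))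
    & fits n (mfinal la (tile_moves T)) /\
      mheight la (tile_moves T) = (\sum_(xi <- T) height xi)%N].
Proof.
elim: T la R => [|xi T IH] la R fla /=.
  by rewrite /tile_union !big_nil setU0.
move=> /and4P[rib dis yng ht] pth hR.
have [[ok d0 fst] [eU eD eh] [tc lar]] := tile_step fla rib dis yng.
rewrite eU in ht.
(* A next tail in a row r' > r would lie in column la r' <= la r, since rows below r are
   unchanged. *)
have hd : head_row_lt T (tail_row xi).+1.
  case: T pth ht {IH} => [//|xi' T] /= /andP[cc _] /and4P[rib' dis' yng' _].
  have [_ _ [tc' _]] := tile_step fst rib' dis' yng'.
  rewrite tc tc' in cc; rewrite ltnS leqNgt; apply/negP => lt.
  have [dla _ _] := fla.
  have [_ h1 _ _] := step_profile dla ok d0.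
  rewrite h1 ?lt ?orbT // in cc.
  by have := decr_le dla (ltnW lt); lia.
have [v a t u [f h]] := IH _ (tail_row xi).+1 fst ht (path_sorted pth) hd.
rewrite hR ok v d0 a t -eD; split=> //.
  by rewrite tile_union_cons setUA eU u.
by rewrite big_cons h eh.
Qed.

(** The bound on the number of cells keeps every intermediate diagram inside the n x n box. *)
Lemma moves_to_tiles N la R s : decr la -> la N = 0%N -> (R <= N)%N ->
  mvalid la R s -> all (fun m => (0 < m.2)%N) s ->
  (\sum_(i < N) la i + \sum_(m <- s) m.2 <= n)%N ->
  [/\ tiles_from (yset n la) (tiles_of la s),
      path ltn (if s is m :: _ then la m.1 else 0%N)
         [seq tail_column xi | xi : {set cell n} <- behead (tiles_of la s)],
      tile_moves (tiles_of la s) = s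
    & if s is m :: _ then
        tail_column (head set0 (tiles_of la s)) = la m.1 else true].
Proof.
elim: s la R => [//|[r d] s IH] la R dla laN RN /= /and3P[rR ok v] /andP[d0 a].
rewrite big_cons /= => sn.
have rN : (r < N)%N by lia.
have p := step_profile dla ok d0.
have ds : decr (step la r d) by apply: step_decr.
have sN : step la r d N = 0%N by have [_ h _ _] := p; rewrite h ?rN ?orbT.
have [ar _ _ _] := p.
have lt := profile_row _ dla p.
have le i : (la i <= step la r d i)%N.
  have [_ h1 _ _] := p; have [h|h] := boolP (step_row la r d <= i <= r)%N.
    by apply: ltnW; rewrite lt.
  by rewrite h1 //; lia.
have rowE : step la r d (step_row la r d) = (la r + d - (r - step_row la r d))%N.
  rewrite /step.
  have -> : ((step_row la r d < step_row la r d) || (r < step_row la r d))%N = false by lia.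
  by rewrite eqxx.
have rowlt := @step_row_lt la r d dla _ ar; rewrite ltnn in rowlt.
have lar := decr_le dla ar.
have sumd M : (r < M)%N -> (\sum_(i < M) (step la r d i - la i) = d)%N.
  move=> rM; have := profile_sum dla p rM; rewrite rowE; move: rowlt lar ar.
  by move: (step_row la r d) (\sum_(i < M) _)%N => a0 S0; lia.
have sumE : (\sum_(i < N) step la r d i = \sum_(i < N) la i + d)%N.
  rewrite -[in RHS](sumd N rN) -big_split /=; apply: eq_bigr => i _; by rewrite subnKC.
have fla : fits n la by apply: (fits_sum dla laN); apply: leq_trans (leq_addr _ _) sn.
have fs : fits n (step la r d).
  by apply: (fits_sum ds sN); rewrite sumE; apply: leq_trans sn; rewrite addnA leq_addr.
rewrite addnA -sumE in sn.
have [tl pth mv hd] := IH (step la r d) r.+1 ds sN rN v a sn.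
have [tc tr] := profile_tail fla fs p.
have rn := profile_lt fla fs p.
have cE : #|yset n (step la r d) :\: yset n la| = d by rewrite card_ribbon // sumd.
have Ue : yset n la :|: (yset n (step la r d) :\: yset n la) = yset n (step la r d).
  apply/setP => -[i j]; rewrite !inE /=; have := le i; lia.
split.
- rewrite Ue tl andbT; apply/and3P; split.
  + exact: profile_ribbon p.
  + by rewrite -setI_eq0 setDE -setIA [~: _ :&: _]setIC setICr setI0.
  + by apply/is_youngP; exists (step la r d).
- rewrite /=; case: s v hd pth {IH a sn tl mv} => [//|[r' d'] s] /= /and3P[r'r _ _] hd pth.
  rewrite hd pth andbT.
  (* Row r has grown past the column of its tail, and the next tail row r' <= r is at least as
     long. *)
  have h : (la r < step la r d r)%N by rewrite lt ar leqnn.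
  by apply: leq_trans h _; apply: decr_le => //; rewrite -ltnS.
- by rewrite /tile_moves /= -/(tile_moves _) mv cE /tail_row tr.
- exact: tc.
Qed.

End Tilings.

(** * Path power sums *)

Section Stabilizer.
Variables (T U : finType) (f : T -> U).

Definition stab (s : {perm T}) : bool := [forall x, f (s x) == f x].

Lemma stabP (s : {perm T}) : reflect (forall x, f (s x) = f x) (stab s).
Proof. by apply: (iffP forallP) => h x; apply/eqP. Qed.

(** A point x of A can go to any y of its fibre in A; composing with the transposition of x and y
    leaves a permutation supported on A minus x, which the induction counts. *)
Lemma card_stab_on (A : {set T}) :
  #|[set s : {perm T} | perm_on A s && stab s]| =
    (\prod_(u : U) #|[set x in A | f x == u]|`!)%N.
Proof.
move En : #|A| => n; elim: n A En => [|n IH] A En.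
  have -> : A = set0 by apply/eqP; rewrite -cards_eq0 En.
  rewrite big1 => [|u _]; last by rewrite (_ : [set x in _ | _] = set0) ?cards0 //;
    apply/setP => x; rewrite !inE.
  rewrite (_ : [set _ | _] = [set 1%g]) ?cards1 //; apply/setP => s; rewrite !inE.
  apply/andP/eqP => [[h _]|->].
    by apply/permP => x; rewrite perm1; apply: (out_perm h); rewrite inE.
  by split; [exact: perm_on1 | apply/stabP => x; rewrite perm1].
have /set0Pn[x xA] : A != set0 by rewrite -cards_eq0 En.
have IHA := IH (A :\ x).
rewrite (cardsD1 x A) xA add1n in En; case: En => /IHA {}IHA.
rewrite (bigD1 (f x)) //=.
have cA : #|[set y in A | f y == f x]| = #|[set y in A :\ x | f y == f x]|.+1.
  rewrite (cardsD1 x) inE xA eqxx add1n; congr _.+1; apply: eq_card => y.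
  by rewrite !inE andbA.
have cO u : u != f x -> #|[set y in A | f y == u]| = #|[set y in A :\ x | f y == u]|.
  move=> ux; apply: eq_card => y; rewrite !inE.
  by have [->|//] := eqVneq y x; rewrite eq_sym (negPf ux) !andbF.
rewrite (eq_bigr (fun u => #|[set y in A :\ x | f y == u]|`!)); last first.
  by move=> u ux; rewrite cO.
rewrite {1}cA factS -mulnA.
have := IHA; rewrite (bigD1 (f x)) //= => <-; rewrite -cA.
rewrite -[LHS]sum1_card.
rewrite (partition_big (fun s : {perm T} => s x)
  (fun y => y \in [set y in A | f y == f x])) /=; last first.
  move=> s; rewrite !inE => /andP[h /stabP st]; by rewrite (perm_closed _ h) xA st eqxx.
rewrite -sum_nat_const; apply: eq_bigr => y; rewrite inE => /andP[yA /eqP fy].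
rewrite (reindex_inj (mulIg (tperm x y))) -sum1_card; apply: eq_bigl => s.
rewrite !inE.
have tst (z : T) : f (tperm x y z) = f z by case: tpermP => [->|->|].
have tA : perm_on A (tperm x y).
  apply/subsetP => z; rewrite inE; case: tpermP => [-> //|-> //|]; by rewrite eqxx.
have -> : stab (s * tperm x y)%g = stab s.
  by apply/stabP/stabP => h z; have := h z; rewrite permM tst.
rewrite permM -andbA [stab s && _]andbC andbA; congr (_ && _).
have xE : (tperm x y (s x) == y) = (s x == x).
  by rewrite -[X in _ == X](tpermL x y) (inj_eq perm_inj).
rewrite xE; apply/andP/idP => [[h /eqP sx]|h].
  apply/subsetP => z; rewrite !inE => sz.
  have zx : z != x by apply: contraNneq sz => ->; rewrite sx.
  rewrite zx /=; apply: (subsetP h); rewrite inE permM.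
  case: tpermP => [e|e|_ _ //].
  - by move: zx; rewrite -(inj_eq (@perm_inj _ s)) sx e eqxx.
  - by rewrite eq_sym.
have sx : s x = x by apply: (out_perm h); rewrite !inE eqxx.
split; last by rewrite sx.
apply: perm_onM => //; apply: subset_trans h _; exact: subsetDl.
Qed.

Lemma card_stab :
  #|[set s : {perm T} | stab s]| = (\prod_(u : U) #|[set x | f x == u]|`!)%N.
Proof.
rewrite -(eq_card (A := [set s : {perm T} | perm_on setT s && stab s])).
  by rewrite card_stab_on; apply: eq_bigr => u _; congr _`!; apply: eq_card => x; rewrite !inE.
by move=> s; rewrite !inE (_ : perm_on _ _) //; apply/subsetP => x; rewrite !inE.
Qed.

Lemma sum_stab_coset (V : nmodType) (s0 : {perm T}) (v : V) :
  \sum_(s : {perm T} | [forall x, f (s x) == f (s0 x)]) v = v *+ #|[set s | stab s]|.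
Proof.
rewrite -sumr_const (reindex_inj (mulgI s0)) /=; apply: eq_bigl => s; rewrite inE.
apply/forallP/stabP => h x; last by rewrite permM h.
by have /eqP := h (s0^-1 x)%g; rewrite permM permKV.
Qed.

End Stabilizer.

Section CycleType.
Variables (R : comNzRingType) (n N : nat).

(** Choosing a variable for each orbit is choosing an invariant colouring of the points; each point
    of the orbit contributes one factor. *)
Lemma psum_cycle (w : 'S_n) :
  psum R N (cycle_type w) =
  \sum_(g : {ffun 'I_n -> 'I_N} | [forall v, g (w v) == g v]) \prod_v 'X_(g v).
Proof.
rewrite /psum /cycle_type (perm_big _ (permEl (perm_sort _ _))) big_image /=.
rewrite (big_sub (mem (porbits w))) bigA_distr_bigA /=.
pose orb (v : 'I_n) : {X in porbits w} := Sub (porbit w v) (imset_f _ isT).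
pose G (h : {ffun {X in porbits w} -> 'I_N}) : {ffun 'I_n -> 'I_N} := [ffun v => h (orb v)].
have orbP (X : {X in porbits w}) : exists v, X = orb v.
  by have /imsetP[v _ e] := valP X; exists v; apply/val_inj; rewrite SubK.
have Ginj : injective G.
  move=> h h' e; apply/ffunP => X; have [v ->] := orbP X.
  by have /ffunP/(_ v) := e; rewrite !ffunE.
have Gim : G @: setT = [set g : {ffun 'I_n -> 'I_N} | [forall v, g (w v) == g v]].
  apply/setP => g; rewrite inE; apply/imsetP/forallP => [[h _ ->] v|hg].
    rewrite !ffunE; apply/eqP; congr (h _); apply/val_inj; rewrite !SubK.
    by apply/eqP; rewrite eq_porbit_mem; have := mem_porbit w 1 v; rewrite expg1.
  have [h hh] : exists h : {X in porbits w} -> 'I_N,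
      forall X v, orb v = X -> h X = g v.
    apply: (@fin_all_exists _ (fun=> 'I_N) (fun X i => forall v, orb v = X -> i = g v)) => X.
    have [v0 ->] := orbP X; exists (g v0) => v /(congr1 val); rewrite !SubK => /eqP.
    rewrite eq_porbit_mem => /porbitP[i ->]; elim: i => [|i IH].
      by rewrite expg0 perm1.
    by rewrite expgSr permM IH; apply/eqP; rewrite eq_sym.
  exists [ffun X => h X] => //; apply/ffunP => v; by rewrite !ffunE (hh _ v).
transitivity (\sum_(g in G @: setT) \prod_v ('X_(g v) : {mpoly R[N]})); last first.
  by rewrite Gim; apply: eq_bigl => g; rewrite inE.
rewrite big_imset /=; last by move=> ? ? _ _; apply: Ginj.
apply: eq_big => [h|h _]; first by rewrite inE.
rewrite [RHS](partition_big orb xpredT) //=; apply: eq_bigr => X _.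
rewrite (eq_bigr (fun=> 'X_(h X))); last by move=> v /eqP <-; rewrite ffunE.
rewrite prodr_const; congr (_ ^+ _); apply: eq_card => v.
have [v0 ->] := orbP X; rewrite SubK [RHS]unfold_in /=.
by rewrite -eq_porbit_mem -val_eqE.
Qed.

Lemma psum_cycleJ (w v : 'S_n) :
  psum R N (cycle_type (v * w * v^-1)%g) = psum R N (cycle_type w).
Proof.
rewrite !psum_cycle.
pose h (g : {ffun 'I_n -> 'I_N}) : {ffun 'I_n -> 'I_N} := [ffun i => g (v i)].
have hinj : injective h.
  move=> g g' e; apply/ffunP => i; have /ffunP/(_ (v^-1 i)%g) := e.
  by rewrite !ffunE permKV.
rewrite (reindex_inj hinj); apply: eq_big => [g|g _].
  apply/forallP/forallP => H i.
    by have := H (v^-1 i)%g; rewrite !ffunE !permM !permKV.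
  by rewrite !ffunE !permM permKV.
rewrite [RHS](reindex_inj (@perm_inj _ v)); apply: eq_bigr => i _.
by rewrite ffunE.
Qed.

End CycleType.

(** The power sum of the cycle type is a class function, so every conjugating [v] contributes the
    same sum. One factor 1/n! cancels against their number, the other against the n! of [atomic]. *)
Lemma atomicE (C : numFieldType) n N (I J : seq 'I_n) :
  atomic C N I J =
  \sum_(w : 'S_n | [seq w i | i <- I] == J) psum C N (cycle_type w).
Proof.
have fn0 : (n`!%:R : C) != 0 by rewrite Num.Theory.pnatr_eq0 -lt0n fact_gt0.
rewrite /atomic /frobenius_ch scalerA divff // scale1r.
transitivity (\sum_(w : 'S_n) \sum_(v : 'S_n) (n`!%:R^-1 : C) *:
    (pp_indicator C I J (v * w * v^-1)%g *: psum C N (cycle_type w))).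
  apply: eq_bigr => w _; rewrite /reynolds -scalerA scaler_suml scaler_sumr.
  by apply: eq_bigr => v _.
rewrite exchange_big /=.
transitivity (\sum_(v : 'S_n) (n`!%:R^-1 : C) *: \sum_(w : 'S_n)
    pp_indicator C I J w *: psum C N (cycle_type w)).
  apply: eq_bigr => v _; rewrite -scaler_sumr; congr (_ *: _).
  have cinj : injective (fun w : 'S_n => (v^-1 * w * v)%g).
    by move=> w w' /mulIg /mulgI.
  rewrite (reindex_inj cinj) /=; apply: eq_bigr => w _.
  rewrite -[X in _ = _ *: psum _ _ (cycle_type X)]/w.
  have e : (v * (v^-1 * w * v) * v^-1)%g = w by rewrite !mulgA mulgV mul1g mulgK.
  by rewrite e -(psum_cycleJ C N _ v) e.
rewrite sumr_const card_Sn -scaler_nat scalerA divff // scale1r [RHS]big_mkcond.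
apply: eq_bigr => w _; rewrite /pp_indicator; case: eqP => _; by rewrite ?scale1r ?scale0r.
Qed.

(* V is a disjoint union of paths indexed by P; u closes up each path into a
   cycle, so the permutations extending the paths are those that agree with u
   except at the ends of the paths, whose images are permuted starts. *)
Section PathClosure.
Variables (V P X : finType) (u : {perm V}) (idx : V -> P) (st : P -> V).
Hypotheses (stK : cancel st idx) (idx_u : forall v, idx (u v) = idx v).
Hypothesis path_const : forall g : V -> X,
  (forall v, u v != st (idx (u v)) -> g (u v) = g v) ->
  forall v, g v = g (st (idx v)).

Definition extends_paths (w : {perm V}) : bool :=
  [forall v, (u v != st (idx (u v))) ==> (w v == u v)].

Definition permute_starts (s : {perm P}) (v : V) : V :=
  if v == st (idx v) then st (s (idx v)) else v.

Lemma permute_starts_inj s : injective (permute_starts s).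
Proof.
move=> v v'; rewrite /permute_starts; case: eqP => e; case: eqP => e'.
- by move=> /(can_inj stK)/perm_inj e2; rewrite e e' e2.
- by move=> e2; rewrite -e2 stK in e'.
- by move=> e2; rewrite e2 stK in e.
- by [].
Qed.

(** The end of path p, which [u] sends back to the start of p, is redirected to the start of path s
    p. *)
Definition join_paths (s : {perm P}) : {perm V} := (u * perm (@permute_starts_inj s))%g.

Lemma join_pathsE s v : join_paths s v = permute_starts s (u v).
Proof. by rewrite permM permE. Qed.

Lemma join_paths_start s p : join_paths s (u^-1 (st p))%g = st (s p).
Proof. by rewrite join_pathsE permKV /permute_starts stK eqxx. Qed.

Lemma join_paths_inj : injective join_paths.
Proof.
move=> s s' e; apply/permP => p; apply: (can_inj stK).
by rewrite -!join_paths_start e.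
Qed.

(** In an extension [w], every vertex that is not a start is already the image of its predecessor.
    By injectivity the ends go to starts, which defines s. *)
Lemma join_paths_image : join_paths @: setT = [set w | extends_paths w].
Proof.
apply/setP => w; rewrite inE; apply/imsetP/forallP => [[s _ ->] v|ext].
  by apply/implyP => h; rewrite join_pathsE /permute_starts (negPf h).
have ext' y : y != st (idx y) -> w (u^-1 y)%g = y.
  by move=> hy; have /implyP := ext (u^-1 y)%g; rewrite permKV => /(_ hy)/eqP.
have wst p : w (u^-1 (st p))%g = st (idx (w (u^-1 (st p))%g)).
  apply/eqP; apply: contraT => h.
  have e : w (u^-1 (st p))%g = st p by have := ext' _ h => /perm_inj/perm_inj.
  by rewrite e stK eqxx in h.
have sinj : injective (fun p => idx (w (u^-1 (st p))%g)).
  move=> p q e; apply: (can_inj stK); apply: (@perm_inj _ u^-1%g).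
  by apply: (@perm_inj _ w); rewrite wst e -wst.
exists (perm sinj) => //; apply/permP => v; rewrite join_pathsE /permute_starts.
case: eqP => [e|/eqP h]; last by have := ext' _ h; rewrite permK.
by rewrite permE -wst -e permK.
Qed.

Definition path_pull (f : {ffun P -> X}) : {ffun V -> X} := [ffun v => f (idx v)].

Lemma path_pull_inj : injective path_pull.
Proof.
move=> f f' e; apply/ffunP => p.
by have /ffunP/(_ (st p)) := e; rewrite !ffunE stK.
Qed.

(** An invariant colouring is constant along each path, hence comes from a colouring of the paths
    that is invariant under [s]. *)
Lemma path_pull_image s : path_pull @: [set f : {ffun P -> X} | stab f s] =
  [set g : {ffun V -> X} | stab g (join_paths s)].
Proof.
apply/setP => g; rewrite inE; apply/imsetP/stabP => [[f + ->] v|hg].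
  rewrite inE => /stabP hf; rewrite !ffunE join_pathsE /permute_starts idx_u.
  by case: ifP => _; rewrite ?stK ?hf ?idx_u.
have cst : forall v, g v = g (st (idx v)).
  apply: path_const => v h.
  by rewrite -(hg v) join_pathsE /permute_starts (negPf h).
exists [ffun p => g (st p)]; last by apply/ffunP => v; rewrite !ffunE -cst.
rewrite inE; apply/stabP => p; rewrite !ffunE -join_paths_start hg cst.
by rewrite -idx_u permKV stK.
Qed.

Lemma sum_extends_paths (K : comNzRingType) (z : X -> K) :
  \sum_(w : {perm V} | extends_paths w)
    \sum_(g : {ffun V -> X} | [forall v, g (w v) == g v]) \prod_v z (g v) =
  \sum_(s : {perm P}) \sum_(f : {ffun P -> X} | stab f s)
     \prod_p z (f p) ^+ #|[set v | idx v == p]|.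
Proof.
transitivity (\sum_(w in join_paths @: setT)
    \sum_(g : {ffun V -> X} | [forall v, g (w v) == g v]) \prod_v z (g v)).
  by rewrite join_paths_image; apply: eq_bigl => w; rewrite inE.
rewrite big_imset /=; last by move=> ? ? _ _; apply: join_paths_inj.
apply: eq_big => [s|s _]; first by rewrite inE.
transitivity (\sum_(g in path_pull @: [set f : {ffun P -> X} | stab f s])
    \prod_v z (g v)).
  by rewrite path_pull_image; apply: eq_bigl => g; rewrite inE.
rewrite big_imset /=; last by move=> ? ? _ _; apply: path_pull_inj.
apply: eq_big => [f|f _]; first by rewrite inE.
rewrite (partition_big idx xpredT) //=; apply: eq_bigr => p _.
rewrite (eq_bigr (fun=> z (f p))); last by move=> v /eqP <-; rewrite ffunE.
rewrite prodr_const; congr (_ ^+ _); apply: eq_card => v; by rewrite !inE.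
Qed.

End PathClosure.

Section SortedColourings.
Variables (k N : nat) (K : comNzRingType) (z : 'I_N -> K).

Definition nondecreasing (f : 'I_k -> 'I_N) : bool :=
  sorted leq [seq (f i : nat) | i <- enum 'I_k].

(** Here [s0] sorts [f]. The sorted rearrangement is unique, so [s0 * s] sorts [f] exactly when it
    gives the same sequence as [s0]. *)
Lemma sort_perm (f : 'I_k -> 'I_N) :
  exists s0 : 'S_k, forall s : 'S_k,
    nondecreasing (fun i => f ((s0 * s)%g i)) = stab f s.
Proof.
pose t : k.-tuple nat := [tuple of [seq (f i : nat) | i <- ord_tuple k]].
have /tuple_permP[s0 e0] : perm_eq (sort leq t) t by rewrite perm_sort.
have tE i : tnth t i = f i by rewrite tnth_map tnth_ord_tuple.
have nE (s : 'S_k) : [seq (f (s i) : nat) | i <- enum 'I_k] = [tuple tnth t (s i) | i < k].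
  by rewrite /=; apply: eq_map => i; rewrite tE.
have sE : sort leq t = [seq (f (s0 i) : nat) | i <- enum 'I_k] by rewrite e0 nE.
exists s0 => s; rewrite /nondecreasing.
have pE : perm_eq [seq (f ((s0 * s)%g i) : nat) | i <- enum 'I_k] (sort leq t).
  by rewrite perm_sym perm_sort perm_sym; apply/tuple_permP; exists (s0 * s)%g; rewrite -nE.
apply/idP/stabP => [h|h].
  have e := sorted_eq leq_trans anti_leq h (sort_sorted leq_total t) pE.
  move=> x; apply/val_inj; rewrite sE in e.
  have /eq_in_map/(_ (s0^-1 x)%g) := e; rewrite mem_enum => /(_ isT).
  by rewrite permM permKV.
have -> : [seq (f ((s0 * s)%g i) : nat) | i <- enum 'I_k] = sort leq t.
  by rewrite sE; apply: eq_map => i; rewrite permM h.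
exact: sort_sorted leq_total _.
Qed.

Definition hmono (al : 'I_k -> nat) : K :=
  \sum_(f : {ffun 'I_k -> 'I_N} | nondecreasing f) \prod_j z (f j) ^+ al j.

(* Both sides count, for each colouring f, a coset of the stabilizer of f. *)
Lemma sum_stab_nondecreasing (mu : 'I_k -> nat) :
  \sum_(s : 'S_k) \sum_(f : {ffun 'I_k -> 'I_N} | stab f s) \prod_p z (f p) ^+ mu p
  = \sum_(s : 'S_k) hmono (fun j => mu (s j)).
Proof.
rewrite (exchange_big_dep xpredT) //=.
transitivity (\sum_(f : {ffun 'I_k -> 'I_N})
    \sum_(s : 'S_k | nondecreasing (fun i => f (s i))) \prod_p z (f p) ^+ mu p).
  apply: eq_bigr => f _; have [s0 h0] := sort_perm f.
  by rewrite [RHS](reindex_inj (mulgI s0)); apply: eq_bigl => s; rewrite h0.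
rewrite (exchange_big_dep xpredT) //=; apply: eq_bigr => s _.
pose h (f : {ffun 'I_k -> 'I_N}) : {ffun 'I_k -> 'I_N} := [ffun p => f (s^-1 p)%g].
have hinj : injective h.
  by move=> f f' e; apply/ffunP => i; have /ffunP/(_ (s i)) := e; rewrite !ffunE permK.
rewrite (reindex_inj hinj) /hmono; apply: eq_big => [f|f _].
  rewrite /nondecreasing; congr sorted; apply: eq_map => i; by rewrite ffunE permK.
rewrite (reindex_inj (@perm_inj _ s)); apply: eq_bigr => i _.
by rewrite ffunE permK.
Qed.

End SortedColourings.

(** Each rearrangement of [mu] arises from one coset of the stabilizer of [mu]; this is the origin
    of the factor m(mu)!. *)
Lemma sum_rearrangements (k m : nat) (V : nmodType) (mu : {ffun 'I_k -> 'I_m})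
    (Phi : {ffun 'I_k -> 'I_m} -> V) :
  \sum_(s : 'S_k) Phi [ffun j => mu (s j)] =
  (\sum_(al : {ffun 'I_k -> 'I_m} |
     perm_eq [seq al j | j <- enum 'I_k] [seq mu j | j <- enum 'I_k]) Phi al)
     *+ #|[set s | stab mu s]|.
Proof.
rewrite (partition_big (fun s : 'S_k => [ffun j => mu (s j)]) (fun al : {ffun 'I_k -> 'I_m} =>
     perm_eq [seq al j | j <- enum 'I_k] [seq mu j | j <- enum 'I_k])) /=; last first.
  move=> s _; pose t : k.-tuple 'I_m := [tuple of [seq mu i | i <- ord_tuple k]].
  rewrite -[X in perm_eq _ X]/(tval t); apply/tuple_permP; exists s.
  by rewrite /=; apply: eq_map => i; rewrite ffunE tnth_map tnth_ord_tuple.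
rewrite -sumrMnl; apply: eq_bigr => al hal.
have [s0 e0] : exists s0 : 'S_k, forall j, al j = mu (s0 j).
  pose t : k.-tuple 'I_m := [tuple of [seq mu i | i <- ord_tuple k]].
  move: hal; rewrite -[X in perm_eq _ X]/(tval t) => /tuple_permP[s0 /eq_in_map e].
  exists s0 => j; have := e j; rewrite mem_enum => /(_ isT) ->.
  by rewrite tnth_map tnth_ord_tuple.
rewrite -(sum_stab_coset mu s0 (Phi al)); apply: eq_big => [s|s /eqP -> //].
apply/eqP/forallP => [e j|h]; last by apply/ffunP => j; rewrite ffunE e0; apply/eqP.
by rewrite -e0 -e ffunE.
Qed.

(** * The paths on consecutive intervals *)

Lemma mem_zip_iota m a x y :
  ((x, y) \in zip (iota m a) (behead (iota m a))) =
    [&& (m <= x)%N, y == x.+1 & (y < m + a)%N].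
Proof.
elim: a m => [|[|a] IH] m /=; first by rewrite in_nil; lia.
  by rewrite in_nil; lia.
have := IH m.+1; rewrite /= in_cons => ->; rewrite xpair_eqE.
by case: (eqVneq x m) => [->|]; case: (eqVneq y m.+1) => [->|]; lia.
Qed.

Lemma mem_path_edges_iota mu m x y : 0%N \notin mu ->
  ((x, y) \in path_edges (reshape mu (iota m (sumn mu)))) =
  [&& (m <= x)%N, y == x.+1, (y < m + sumn mu)%N
    & [forall p : 'I_(size mu), y != (m + sumn (take p mu))%N]].
Proof.
elim: mu m => [|a mu IH] m.
  by rewrite /path_edges /= in_nil addn0 => _; lia.
rewrite in_cons negb_or => /andP[a0 mu0].
rewrite /path_edges /= mem_cat -/(path_edges _).
rewrite iotaD take_size_cat ?size_iota // drop_size_cat ?size_iota //.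
rewrite mem_zip_iota IH //.
have -> : [forall p : 'I_(size mu).+1, y != (m + sumn (take p (a :: mu)))%N] =
   (y != m) && [forall p : 'I_(size mu), y != (m + a + sumn (take p mu))%N].
  apply/forallP/andP => [h|[h1 /forallP h2] p].
    split; first by have := h ord0; rewrite /= addn0.
    by apply/forallP => p; have := h (lift ord0 p); rewrite /= addnA.
  case: (unliftP ord0 p) => [q ->|->]; last by rewrite /= addn0.
  by have := h2 q; rewrite /= addnA.
set F := [forall p, _].
have hF : y != (m + a)%N -> (y < m + a)%N -> F.
  by move=> _ h; apply/forallP => p; lia.
have hF2 : F -> (0 < size mu)%N -> y != (m + a)%N.
  move=> /forallP h s0; have := h (Ordinal s0); by rewrite /= take0 addn0.
have hs : size mu = 0%N -> sumn mu = 0%N by move/size0nil ->.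
case: (ltnP y (m + a)) => h1.
  rewrite hF //; lia.
case: (boolP F) => hf; last by rewrite !andbF orbF; lia.
by have := hF2 hf; lia.
Qed.

Section ConcretePaths.
Variables (n : nat) (mu : seq nat).
Hypothesis (mu_n : is_part_of n mu).
Let k := size mu.
Let S p := sumn (take p mu).

Let mu0 : 0%N \notin mu. Proof. by case/andP: mu_n => /andP[]. Qed.
Let smu : sumn mu = n. Proof. by case/andP: mu_n => _ /eqP. Qed.

Let SS p : (p < k)%N -> S p.+1 = (S p + nth 0 mu p)%N.
Proof. by move=> pk; rewrite /S (take_nth 0%N) // sumn_rcons. Qed.

Let part_gt0 p : (p < k)%N -> (0 < nth 0 mu p)%N.
Proof. by move=> pk; rewrite lt0n; apply: contraNneq mu0 => <-; apply: mem_nth. Qed.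

Let Sk : S k = n. Proof. by rewrite /S take_size. Qed.

Let S_le p q : (p <= q)%N -> (S p <= S q)%N.
Proof.
elim: q => [|q IH]; first by rewrite leqn0 => /eqP ->.
rewrite leq_eqVlt => /orP[/eqP->//|]; rewrite ltnS => /IH h; apply: leq_trans h _.
have [qk|kq] := ltnP q k; first by rewrite SS // leq_addr.
by rewrite /S !take_oversize //; apply: leqW.
Qed.

Let S_lt p q : (p < q)%N -> (p < k)%N -> (S p < S q)%N.
Proof.
by move=> pq pk; apply: leq_trans (S_le pq); rewrite SS // -addn1 leq_add2l part_gt0.
Qed.

Let path_index x := find (fun p => x < S p.+1)%N (iota 0 k).

Let path_indexP x : (x < n)%N ->
  [/\ (path_index x < k)%N, (S (path_index x) <= x)%N & (x < S (path_index x).+1)%N].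
Proof.
move=> xn; have k0 : (0 < k)%N.
  by rewrite lt0n; apply/eqP => e; move: xn; rewrite -Sk e /S take0.
have hs : has (fun p => x < S p.+1)%N (iota 0 k).
  by apply/hasP; exists k.-1; rewrite ?mem_iota ?prednK ?Sk // add0n leqnn.
have lt : (path_index x < k)%N by move: hs; rewrite has_find size_iota.
split=> //; last by have := nth_find 0%N hs; rewrite nth_iota.
case E : (path_index x) => [|p]; first by rewrite /S take0.
have pp : (p < path_index x)%N by rewrite E.
have := before_find 0%N pp; rewrite nth_iota ?add0n; last by lia.
by move/negbT; rewrite -leqNgt.
Qed.

Let path_index_uniq x p : (p < k)%N -> (S p <= x < S p.+1)%N -> path_index x = p.
Proof.
move=> pk /andP[h1 h2].
have xn : (x < n)%N by rewrite -Sk; apply: leq_trans h2 _; apply: S_le.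
have [lt g1 g2] := path_indexP xn.
by case: (ltngtP (path_index x) p) => // h; have := S_le h; lia.
Qed.

Let idx (x : 'I_n) : 'I_k :=
  Ordinal (let: And3 h _ _ := path_indexP (ltn_ord x) in h).

Let idxP (x : 'I_n) : (S (idx x) <= x)%N /\ (x < S (idx x).+1)%N.
Proof. by have [_ h1 h2] := path_indexP (ltn_ord x); split; [exact: h1 | exact: h2]. Qed.

Let idx_uniq (x : 'I_n) (p : 'I_k) : (S p <= x < S p.+1)%N -> idx x = p.
Proof. by move=> h; apply/val_inj; apply: (path_index_uniq (ltn_ord p) h). Qed.

Let st_lt (p : 'I_k) : (S p < n)%N.
Proof. by rewrite -Sk; apply: (S_lt (ltn_ord p) (ltn_ord p)). Qed.

Let st (p : 'I_k) : 'I_n := Ordinal (st_lt p).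

Let stK : cancel st idx.
Proof. by move=> p; apply: idx_uniq; rewrite /= leqnn S_lt. Qed.

(** The cyclic successor within an interval: the last vertex returns to the start. *)
Let next (x : 'I_n) : nat := if x.+1 == S (idx x).+1 then S (idx x) else x.+1.

Let next_lt x : (next x < n)%N.
Proof.
have [h1 h2] := idxP x; rewrite /next; case: eqP => h; first exact: st_lt (idx x).
have := S_le (ltn_ord (idx x)); rewrite Sk; lia.
Qed.

Let idx_next x : idx (Ordinal (next_lt x)) = idx x.
Proof.
apply: idx_uniq; rewrite /= /next; have [h1 h2] := idxP x.
case: eqP => h; first by rewrite leqnn S_lt.
by rewrite (leqW h1) ltn_neqAle h2 andbT; apply/eqP.
Qed.

Let next_inj : injective (fun x => Ordinal (next_lt x)).
Proof.
move=> x y e; have ei : idx x = idx y by rewrite -idx_next e idx_next.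
move: (congr1 val e); rewrite /= /next ei; have [h1 h2] := idxP x; have [h3 h4] := idxP y.
rewrite ei in h1 h2.
by case: eqP => ?; case: eqP => ? ?; apply/val_inj => /=; lia.
Qed.

Let u : 'S_n := perm next_inj.

Let uE x : u x = next x :> nat. Proof. by rewrite permE. Qed.

Let idx_u x : idx (u x) = idx x. Proof. by rewrite permE idx_next. Qed.

(** Going back one vertex at a time reaches the start of the interval without a change of colour. *)
Let path_const (X : finType) (g : 'I_n -> X) :
  (forall v, u v != st (idx (u v)) -> g (u v) = g v) ->
  forall v, g v = g (st (idx v)).
Proof.
move=> hg v; move Em : (v : nat) => m; elim: m v Em => [|m IH] v Em.
  congr g; apply/val_inj; have [h1 _] := idxP v; move: h1; rewrite /= Em leqn0.
  by move/eqP.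
have [e|ne] := eqVneq v (st (idx v)); first by rewrite {1}e.
have [h1 h2] := idxP v.
have h1' : (S (idx v) < v)%N.
  by rewrite ltn_neqAle h1 andbT eq_sym; apply: contraNneq ne => e; apply/eqP/val_inj.
have mn : (m < n)%N by have := ltn_ord v; lia.
have iv : idx (Ordinal mn) = idx v.
  apply: idx_uniq; apply/andP; split; first by rewrite -ltnS -Em.
  by apply: leq_trans h2; rewrite /= Em.
have uv : u (Ordinal mn) = v.
  apply/val_inj; rewrite [LHS]uE /next iv /= -Em; case: eqP => // e.
  by move: h2; rewrite e ltnn.
by have := hg (Ordinal mn); rewrite uv => -> //; rewrite (IH (Ordinal mn)) // iv.
Qed.

Let E := path_edges (reshape mu (enum 'I_n)).

Let mem_E (x y : 'I_n) : ((x, y) \in E) = (y == x.+1 :> nat) && (y != st (idx y)).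
Proof.
have -> : ((x, y) \in E) = ((val x, val y) \in [seq (val e.1, val e.2) | e <- E]).
  apply/idP/mapP => [h|[[a b] h /= [/val_inj -> /val_inj ->]] //].
  by exists (x, y).
rewrite -path_edges_map -/(map (map val)) map_reshape val_enum_ord -[n in iota _ n]smu.
rewrite mem_path_edges_iota // add0n smu ltn_ord leq0n /=; congr (_ && _).
apply/forallP/idP => [h|h p].
  by apply/eqP => e; have := h (idx y); rewrite {1}e /= eqxx.
apply: contra h => /eqP; rewrite add0n => e.
have ip : idx y = p by apply: idx_uniq; rewrite e leqnn; apply: S_lt.
by rewrite ip; apply/eqP/val_inj.
Qed.

(** [u] follows the edges except at the last vertex of an interval, so the sources of edges are the
    vertices whose image under [u] is not a start. *)
Let extendsE (w : 'S_n) :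
  ([seq w i | i <- unzip1 E] == unzip2 E) = extends_paths u idx st w.
Proof.
have sz : size (unzip1 E) = size (unzip2 E) by rewrite !size_map.
apply/(pp_imageP w sz)/forallP => [h x|h x y].
  apply/implyP => nst; apply/eqP/h; rewrite /pp_edge zip_unzip mem_E nst andbT.
  rewrite uE /next; case: ifP => [/eqP e|_]; last by rewrite eqxx.
  case/eqP: nst; rewrite idx_u; apply/val_inj.
  by rewrite [LHS]uE /next e eqxx.
rewrite /pp_edge zip_unzip mem_E => /andP[/eqP e nst].
have uxy : u x = y.
  apply/val_inj; rewrite [LHS]uE /next -e; case: eqP => // e2.
  case/eqP: nst.
  have hk : ((idx x).+1 < k)%N.
    rewrite ltn_neqAle ltn_ord andbT; apply/eqP => e3.
    by move: e2; rewrite e3 Sk => e4; have := ltn_ord y; rewrite e4 ltnn.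
  have iy : idx y = Ordinal hk.
    by apply: idx_uniq; rewrite e2 leqnn; apply: S_lt.
  by rewrite iy; apply/val_inj.
by have /implyP := h x; rewrite uxy => /(_ nst)/eqP.
Qed.

Let card_idx (p : 'I_k) : #|[set v | idx v == p]| = nth 0%N mu p.
Proof.
have Sn : (S p.+1 <= n)%N by rewrite -Sk; apply: S_le.
rewrite -[RHS](addKn (S p)) -SS // -(card_ord_interval (S p) Sn).
apply: eq_card => v; rewrite !inE; apply/eqP/idP => [<-|h]; last exact: idx_uniq.
by have [-> ->] := idxP v.
Qed.

Lemma path_psum_hmono (C : numFieldType) N :
  path_psum C n N mu =
  \sum_(s : 'S_(size mu))
    hmono (fun i : 'I_N => 'X_i : {mpoly C[N]}) (fun j => nth 0%N mu (s j)).
Proof.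
rewrite /path_psum atomicE.
under eq_bigl do rewrite extendsE.
under eq_bigr do rewrite psum_cycle.
rewrite (sum_extends_paths stK idx_u (@path_const _)
  (fun i : 'I_N => 'X_i : {mpoly C[N]})) .
rewrite -(sum_stab_nondecreasing _ (fun j : 'I_k => nth 0%N mu j)).
apply: eq_bigr => s _; apply: eq_bigr => f _; apply: eq_bigr => p _.
by rewrite card_idx.
Qed.

End ConcretePaths.

(** * Comparison of coefficients *)

Lemma hsym_nondecreasing (K : comNzRingType) k N (y : nat -> K) :
  hsym k [seq y i | i : 'I_N <- enum 'I_N] =
  \sum_(f : {ffun 'I_k -> 'I_N} | nondecreasing f) \prod_j y (f j).
Proof.
rewrite /hsym msel_map big_map.
pose L (f : {ffun 'I_k -> 'I_N}) := [seq f j | j <- enum 'I_k].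
have Linj : injective L.
  move=> f g /eq_in_map e; apply/ffunP => j; apply: e; exact: mem_enum.
rewrite (perm_big [seq L f | f <- [seq f : {ffun 'I_k -> 'I_N} <-
  enum {ffun 'I_k -> 'I_N} | nondecreasing f]]) /=.
  rewrite big_map big_filter big_enum_cond /=; apply: eq_bigr => f _.
  by rewrite /L 2!big_map big_enum.
apply: uniq_perm.
- exact/uniq_msel/enum_uniq.
- by rewrite map_inj_uniq // filter_uniq ?enum_uniq.
move=> s; rewrite (@mem_msel _ (fun u v : 'I_N => u < v)%N).
- apply/and3P/mapP => [[/eqP sz _ srt]|[f + ->]].
    have szk : size s == k by apply/eqP.
    exists [ffun j => tnth (Tuple szk) j]; last first.
      rewrite /L -[s in LHS]/(tval (Tuple szk)) -[LHS]map_tnth_enum.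
      by apply: eq_map => j; rewrite ffunE.
    rewrite mem_filter mem_enum andbT /nondecreasing.
    have -> : [seq (([ffun j => tnth (Tuple szk) j] : {ffun 'I_k -> 'I_N}) i : nat)
        | i <- enum 'I_k] = map val s.
      rewrite -[s in RHS]/(tval (Tuple szk)) -[in RHS](map_tnth_enum (Tuple szk)).
      by rewrite -[RHS]map_comp; apply: eq_map => j; rewrite /= ffunE.
    rewrite sorted_map; apply: sub_sorted srt => u v /=.
    by case/orP=> [/eqP ->|/ltnW].
  rewrite mem_filter => /andP[nd _]; split.
  + by rewrite size_map size_enum_ord.
  + by apply/allP => i _; apply: mem_enum.
  move: nd; rewrite /nondecreasing /L -[map _ _]/([seq val (f j) | j <- enum 'I_k]).
  rewrite (map_comp val f) sorted_map; apply: sub_sorted => u v /=.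
  by rewrite leq_eqVlt.
- by move=> u v w; apply: ltn_trans.
- by move=> u; apply: ltnn.
- have := iota_ltn_sorted 0 N; rewrite -val_enum_ord sorted_map; exact.
Qed.

Lemma alt_morph (K L : comNzRingType) (phi : {rmorphism K -> L}) (x : nat -> K) N b :
  alt (fun i => phi (x i)) N b = phi (alt x N b).
Proof.
rewrite /alt -det_map_mx; congr (\det _); apply/matrixP => i j.
by rewrite !mxE rmorphXn.
Qed.

Lemma alt_mpolyC (K : comNzRingType) m (x : nat -> K) N b :
  alt (fun i => (x i)%:MP_[m]) N b = (alt x N b)%:MP.
Proof. exact: (alt_morph (@mpolyC m K : {rmorphism K -> {mpoly K[m]}})). Qed.

Section PartMonomial.
Variables (K : comNzRingType) (n : nat).

(** The exponent vector of the product of the t_d for d in [ds]; there are n+1 variables so that t_d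
    has index d. *)
Definition part_mon (ds : seq nat) : 'X_{1..n.+1} :=
  [multinom count_mem (i : nat) ds | i < n.+1].

Lemma part_monE ds i : part_mon ds i = count_mem (i : nat) ds.
Proof. by rewrite multinomE tnth_mktuple. Qed.

Lemma prod_mvar ds : all (fun d => d <= n)%N ds ->
  \prod_(d <- ds) mvar K n.+1 d = 'X_[part_mon ds].
Proof.
elim: ds => [_|d ds IH /= /andP[dn /IH e]].
  have -> : part_mon [::] = 0%MM by apply/mnmP => i; rewrite !mnm0E.
  by rewrite big_nil mpolyX0.
have dn' : (d < n.+1)%N by rewrite ltnS.
rewrite big_cons e (mvarE K (Ordinal dn')) -mpolyXD; congr 'X_[_]; apply/mnmP => i.
by rewrite mnmDE !part_monE /= mnm1E -val_eqE.
Qed.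

Lemma part_mon_eq ds es : all (fun d => d <= n)%N ds -> all (fun d => d <= n)%N es ->
  (part_mon ds == part_mon es) = perm_eq ds es.
Proof.
move=> hd he; apply/eqP/idP => [e|/seq.permP e]; last by apply/mnmP => i; rewrite !part_monE e.
apply/allP => d; rewrite mem_cat => h; apply/eqP.
have dn : (d < n.+1)%N by rewrite ltnS; case/orP: h => [/(allP hd)|/(allP he)].
by have /mnmP/(_ (Ordinal dn)) := e; rewrite !part_monE.
Qed.

Lemma mcoeff_prod_mvar ds es (c : K) :
  all (fun d => d <= n)%N ds -> all (fun d => d <= n)%N es ->
  (\prod_(d <- ds) mvar K n.+1 d * c%:MP)@_(part_mon es) = if perm_eq ds es then c else 0.
Proof.
move=> hd he; rewrite prod_mvar // mulrC mcoeffCM mcoeffX part_mon_eq //.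
by case: ifP; rewrite ?mulr1 ?mulr0.
Qed.

End PartMonomial.

Section Coefficient.
Variables (K : comNzRingType) (x : nat -> K) (n N : nat) (mu : seq nat).
Hypothesis mu_n : is_part_of n mu.
Let k := size mu.
Let x' i : {mpoly K[n.+1]} := (x i)%:MP.
Let tau := mvar K n.+1.
Let y i := \sum_(d <- iota 1 n) tau d * x' i ^+ d.

Let mu_le : all (fun d => d <= n)%N mu.
Proof.
case/andP: mu_n => _ /eqP <-; apply/(all_nthP 0%N) => i _; exact: nth_le_sumn.
Qed.

Let mu_gt0 : 0%N \notin mu. Proof. by case/andP: mu_n => /andP[]. Qed.

Let yE i : y i = \sum_(d < n.+1 | (0 < d)%N) tau d * x' i ^+ d.
Proof.
have -> : y i = \sum_(1 <= d < n.+1) tau d * x' i ^+ d by rewrite /index_iota subn1.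
by rewrite (@big_nat_widenl _ _ _ _ 0) // big_mkord.
Qed.

Lemma mcoeff_hsym :
  (hsym k [seq y i | i : 'I_N <- enum 'I_N])@_(part_mon n mu) =
  \sum_(al : {ffun 'I_k -> 'I_n.+1} |
       perm_eq [seq (al j : nat) | j <- enum 'I_k] mu)
    hmono (fun i : 'I_N => x i) (fun j => al j).
Proof.
rewrite hsym_nondecreasing.
under eq_bigr => f _.
  under eq_bigr do rewrite yE.
  (* Distributing the product chooses an exponent [al j] in the factor at each position j. *)
  rewrite (bigA_distr_big (fun d : 'I_n.+1 => 0 < d)%N (fun j d => tau d * x' (f j) ^+ d)) /=.
  over.
rewrite exchange_big /= raddf_sum /= [RHS]big_mkcond [LHS]big_mkcond /=.
apply: eq_bigr => al _.
set A := [seq (al j : nat) | j <- enum 'I_k].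
have Ale : all (fun d => d <= n)%N A.
  by apply/allP => d /mapP[j _ ->]; rewrite -ltnS.
have -> : (if al \in ffun_on (fun d : 'I_n.+1 => 0 < d)%N then
     (\sum_(f : {ffun 'I_k -> 'I_N} | nondecreasing f)
        \prod_j (tau (al j) * x' (f j) ^+ al j))@_(part_mon n mu) else 0) =
  if al \in ffun_on (fun d : 'I_n.+1 => 0 < d)%N then
     if perm_eq A mu then hmono (fun i : 'I_N => x i) (fun j => al j) else 0 else 0.
  case: ifP => // _; rewrite raddf_sum /=.
  rewrite (eq_bigr (fun f : {ffun 'I_k -> 'I_N} =>
     if perm_eq A mu then \prod_j x (f j) ^+ al j else 0)).
    by case: ifP => _ //; rewrite big1.
  move=> f _; rewrite big_split /= -(mcoeff_prod_mvar _ Ale mu_le); congr (_@_ _).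
  congr (_ * _); first by rewrite /A big_map big_enum.
  rewrite rmorph_prod /=; apply: eq_bigr => j _.
  by rewrite rmorphXn.
case: (boolP (perm_eq A mu)) => [pA|_]; last by case: ifP.
(* The chosen exponents are positive because they rearrange [mu], which has no part 0. *)
rewrite (_ : al \in _) //; apply/ffun_onP => j; rewrite unfold_in lt0n.
apply: contraNneq mu_gt0 => e; rewrite -(perm_mem pA) -e.
by apply/map_f; rewrite mem_enum.
Qed.

(** This is [hsum_moves] from the empty partition with all rows allowed, read at the monomial of
    [mu]: the sequences whose lengths rearrange [mu] remain. *)
Lemma alt_moves :
  alt x N (fun j => N - j.+1)%N *
  \sum_(al : {ffun 'I_k -> 'I_n.+1} |
       perm_eq [seq (al j : nat) | j <- enum 'I_k] mu)
    hmono (fun i : 'I_N => x i) (fun j => al j) =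
  \sum_(s <- allmoves N n k | mvalid (fun=> 0%N) N s && perm_eq (unzip2 s) mu)
    (-1) ^+ mheight (fun=> 0%N) s * alt x N (beta N (mfinal (fun=> 0%N) s)).
Proof.
have := @hsum_moves _ x' y tau N n (fun=> erefl) k N (fun=> 0%N) (fun=> leqnn _) (leqnn N).
rewrite hsum_full => /(congr1 (mcoeff (part_mon n mu))).
rewrite alt_mpolyC.
rewrite mcoeffCM mcoeff_hsym => ->; rewrite raddf_sum /=.
rewrite [RHS]big_mkcondr /= big_seq_cond [RHS]big_seq_cond; apply: eq_bigr => s /andP[+ _].
rewrite mem_allmoves => /andP[_ /allP hs].
have sle : all (fun d => d <= n)%N (unzip2 s).
  by apply/allP => d /mapP[m /hs /andP[_ /andP[_ h]] ->].
rewrite alt_mpolyC.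
rewrite -(mcoeff_prod_mvar _ sle mu_le) /unzip2 big_map; congr (_@_ _); congr (_ * _).
by rewrite rmorphM rmorphXn rmorphN1.
Qed.

End Coefficient.

Section PathPowerSum.
Variables (n : nat) (mu : seq nat).
Hypothesis mu_n : is_part_of n mu.
Let k := size mu.
Let muf : {ffun 'I_k -> 'I_n.+1} := [ffun j : 'I_k => inord (nth 0%N mu j)].

Let mufE j : muf j = nth 0%N mu j :> nat.
Proof.
rewrite ffunE inordK // ltnS; case/andP: mu_n => _ /eqP <-; exact: nth_le_sumn.
Qed.

Let map_muf : [seq (muf j : nat) | j <- enum 'I_k] = mu.
Proof.
rewrite (eq_map mufE) -[RHS](mkseq_nth 0%N) /mkseq -val_enum_ord.
exact: (map_comp (nth 0%N mu) val).
Qed.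

Lemma card_stab_parts : #|[set s : 'S_k | stab muf s]| = mult_fact mu.
Proof.
rewrite card_stab /mult_fact.
transitivity (\prod_(u < n.+1) (count_mem (u : nat) mu)`!)%N.
  apply: eq_bigr => u _; congr _`!; rewrite -[in RHS]map_muf count_map.
  rewrite cardE size_filter -enumT /=; apply: eq_count => j /=.
  by rewrite inE -val_eqE.
(* The product of [mult_fact] begins at 1; the factor at 0 is 0!, since 0 is not a part. *)
rewrite -(big_mkord xpredT (fun u => (count_mem u mu)`!)) big_ltn //.
case/andP: mu_n => /andP[_ mu0] /eqP ->.
by rewrite (count_memPn mu0) fact0 mul1n.
Qed.

Lemma path_psum_mult (C : numFieldType) N :
  path_psum C n N mu = (mult_fact mu)%:R *:
  \sum_(al : {ffun 'I_k -> 'I_n.+1} |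
       perm_eq [seq (al j : nat) | j <- enum 'I_k] mu)
    hmono (fun i : 'I_N => mvar C N i) (fun j => al j).
Proof.
rewrite (path_psum_hmono mu_n) scaler_nat -card_stab_parts.
pose Phi (al : {ffun 'I_k -> 'I_n.+1}) :=
  hmono (fun i : 'I_N => mvar C N i) (fun j => al j).
transitivity (\sum_(s : 'S_k) Phi [ffun j => muf (s j)]).
  apply: eq_bigr => s _; apply: eq_bigr => f _; apply: eq_bigr => j _.
  by rewrite mvarE ffunE mufE.
rewrite sum_rearrangements; congr (_ *+ _); apply: eq_bigl => al.
rewrite -[in RHS]map_muf (map_comp val al) (map_comp val muf).
by apply/idP/idP => [/(perm_map val)|/(perm_map_inj val_inj)].
Qed.

Lemma sort_geq_eq (s : seq nat) : (sort geq s == mu) = perm_eq s mu.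
Proof.
have geq_tr : transitive geq by move=> u v w h1 h2; apply: leq_trans h2 h1.
have geq_tot : total geq by move=> u v; rewrite /geq /= leq_total.
have geq_anti : antisymmetric geq by move=> u v h; apply/anti_leq; rewrite andbC.
apply/eqP/idP => [<-|p]; first by rewrite perm_sym perm_sort.
apply: (sorted_eq geq_tr geq_anti); first exact: sort_sorted.
  by case/andP: mu_n => /andP[].
by rewrite perm_sort.
Qed.

End PathPowerSum.

Lemma mfinal_support N la R s : la N = 0%N -> (R <= N)%N -> mvalid la R s ->
  mfinal la s N = 0%N.
Proof.
elim: s la R => [//|m s IH] la R laN RN /= /and3P[mR _ v].
have mN : (m.1 < N)%N by apply: leq_trans RN.
by apply: IH v => //; rewrite /step mN orbT.
Qed.

(** * From sums over moves to sums over tilings *)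

Section TilingSum.
Variables (n N : nat) (mu : seq nat).
Hypothesis mu_n : is_part_of n mu.
Let k := size mu.
Let la0 : nat -> nat := fun=> 0%N.

Let decr0 : decr la0. Proof. by []. Qed.

Let fits0 : fits n la0. Proof. by split. Qed.

Let yset0 : yset n la0 = set0. Proof. by apply/setP => c; rewrite !inE. Qed.

Let mono_type (T : seq {set cell n}) : bool :=
  is_mono_ribbon_tiling T && (sort geq (tiling_type T) == mu).

Let unzip2_moves (T : seq {set cell n}) : unzip2 (tile_moves T) = tiling_type T.
Proof. by rewrite /unzip2 /tile_moves -map_comp. Qed.

Lemma tiling_data (T : seq {set cell n}) R : mono_type T -> head_row_lt T R ->
  [/\ [/\ mvalid la0 R (tile_moves T), all (fun m => 0 < m.2)%N (tile_moves T),
          tiles_of n la0 (tile_moves T) = T & perm_eq (unzip2 (tile_moves T)) mu],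
      is_part (tiling_shape T), nth 0%N (tiling_shape T) =1 mfinal la0 (tile_moves T)
    & mheight la0 (tile_moves T) = (\sum_(xi <- T) height xi)%N].
Proof.
rewrite /mono_type mono_tilingE -yset0 => /andP[/andP[tl srt] st] hR.
have [v a t u [f h]] := tiles_to_moves fits0 tl srt hR.
rewrite yset0 set0U in u; have [p e] := shape_yset f.
by split; rewrite ?unzip2_moves -?(sort_geq_eq mu_n) // /tiling_shape u.
Qed.

(* The tail of the first tile lies in the last row of the shape. *)
Lemma schur_high (R : comNzRingType) (T : seq {set cell n}) :
  mono_type T -> ~~ head_row_lt T N ->
  schur R N (tiling_shape T) = 0.
Proof.
case: T => [//|xi T] mT; rewrite /= -leqNgt => Nr.
have [_ p e _] := tiling_data (R := (tail_row xi).+1) mT (ltnSn _).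
apply: schur_eq0 => //; move: mT; rewrite /mono_type mono_tilingE => /andP[/andP[tl srt] _].
have [v a t u [f _]] := tiles_to_moves (R := (tail_row xi).+1) fits0
  (eq_rect_r (fun D => tiles_from D (xi :: T)) tl yset0) srt (ltnSn _).
have /and4P[rib dis yng _] := tl.
rewrite -yset0 in dis yng.
have [[_ _ fs] [eU _ _] [_ lt]] := tile_step fits0 rib dis yng.
set r := tail_row xi in Nr lt eU fs *.
have rn : (r < n)%N.
  rewrite ltnNge; apply/negP => h; have [d _ z] := fs.
  by rewrite (decr_eq0 d z h) in lt.
have n0 : (0 < n)%N by apply: leq_ltn_trans rn.
(* The cell (r, 0) lies in the shape, which therefore has more than r >= N rows. *)
have : (Ordinal rn, Ordinal n0) \in yset n (mfinal la0 (tile_moves (xi :: T))).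
  rewrite -u tile_union_cons setUA eU inE; apply/orP; left.
  by rewrite inE /=; apply: leq_ltn_trans lt.
rewrite inE -e => h; rewrite ltnNge; apply/negP => sN.
by rewrite nth_default ?ltnn // in h; apply: leq_trans Nr.
Qed.

(** [tile_moves] is a bijection with inverse [tiles_of]. The condition on the first tail row
    suffices, because later tails are not lower. *)
Lemma sum_moves_tilings (V : nmodType) (F : seq (nat * nat) -> V) :
  \sum_(s <- allmoves N n k | mvalid la0 N s && perm_eq (unzip2 s) mu) F s =
  \sum_(T : k.-tuple {set cell n} | mono_type T && head_row_lt T N) F (tile_moves T).
Proof.
pose P (T : k.-tuple {set cell n}) := mono_type T && head_row_lt T N.
rewrite -big_filter.
rewrite (perm_big [seq tile_moves T | T : k.-tuple {set cell n} <-
  [seq T <- enum {: k.-tuple {set cell n}} | P T]]).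
  by rewrite big_map big_filter big_enum_cond.
apply: uniq_perm.
- by rewrite filter_uniq ?uniq_allmoves.
- rewrite map_inj_in_uniq => [|T T']; first exact/filter_uniq/enum_uniq.
  rewrite !mem_filter => /andP[/andP[m h] _] /andP[/andP[m' h'] _] e.
  have [[_ _ t _] _ _ _] := tiling_data m h; have [[_ _ t' _] _ _ _] := tiling_data m' h'.
  by apply/val_inj; rewrite /= -t e t'.
move=> s; rewrite mem_filter mem_allmoves; apply/idP/mapP.
  case/andP=> /andP[v pm] /andP[/eqP sz hs].
  have hs' : all (fun m => 0 < m.2)%N s.
    by apply: sub_all hs => m /andP[_ /andP[]].
  have sm : (\sum_(i < N) la0 i + \sum_(m <- s) m.2 <= n)%N.
    have -> : (\sum_(m <- s) m.2 = \sum_(d <- unzip2 s) d)%N by rewrite /unzip2 big_map.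
    rewrite big1 // add0n (perm_big mu pm) /= -sumnE.
    by case/andP: mu_n => _ /eqP ->.
  have [tl pth mv hd] := @moves_to_tiles n N la0 N s decr0 erefl (leqnn N) v hs' sm.
  have szT : size (tiles_of n la0 s) == k.
    rewrite -sz -(size_map (fun xi : {set cell n} => (tail_row xi, #|xi|))).
    by rewrite -/(tile_moves _) mv.
  exists (Tuple szT); last by rewrite mv.
  rewrite mem_filter mem_enum andbT /P /mono_type mono_tilingE -yset0 /= tl.
  rewrite (sort_geq_eq mu_n) -unzip2_moves mv pm /= !andbT.
  case: s {hs hs' sm tl sz szT pm} v pth mv hd => [//|m s] /= /and3P[mN _ _] pth mv hd.
  rewrite hd /= in pth *; rewrite pth /=.
  by case: mv => /(congr1 fst) /= -> _.
case=> T; rewrite mem_filter => /andP[/andP[m h] _] ->.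
have [[v a t p] _ _ _] := tiling_data m h.
rewrite v p /= size_map size_tuple eqxx /=; apply/allP => mv hm.
have mN : forall la R s, mvalid la R s -> (R <= N)%N -> all (fun m => m.1 < N)%N s.
  move=> la R s'; elim: s' la R => [//|m' s' IH] la R /= /and3P[h1 _ h2] RN.
  rewrite (leq_trans h1 RN) /=; apply: IH h2 _; exact: leq_trans RN.
rewrite (allP (mN _ _ _ v (leqnn N)) mv hm) (allP a mv hm) /=.
have : mv.2 \in mu by rewrite -(perm_mem p); apply: map_f.
move/(nthP 0%N) => [i _ <-]; case/andP: mu_n => _ /eqP <-; exact: nth_le_sumn.
Qed.

End TilingSum.

Theorem theorem5p13 (C : numClosedFieldType) (n : nat) (mu : seq nat)
    (mu_n : is_part_of n mu) (N : nat) :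
  path_psum C n N mu =
    (mult_fact mu)%:R *:
      \sum_(T : (size mu).-tuple {set cell n} |
              is_mono_ribbon_tiling T && (sort geq (tiling_type T) == mu))
        tiling_sign C T *: schur C N (tiling_shape T).
Proof.
rewrite (path_psum_mult mu_n); congr (_ *: _).
(* Multiplying both sides by a_delta turns each Schur polynomial into an alternant. *)
apply: (mulfI (alt_delta_neq0 C (leqnn N))).
rewrite alt_moves // sum_moves_tilings // mulr_sumr.
(* Tilings whose first tail lies in row N or below are not reached by moves of N beads; their Schur
   polynomials are 0. *)
rewrite [RHS](bigID (fun T : (size mu).-tuple _ => head_row_lt T N)) /=.
rewrite [X in _ = _ + X]big1 ?addr0 => [|T /andP[mT hT]]; last first.
  by rewrite (schur_high mu_n) // scaler0 mulr0.
apply: eq_bigr => T /andP[mT hT].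
have [[v _ _ _] p e h] := tiling_data mu_n mT hT.
have sN : (size (tiling_shape T) <= N)%N.
  rewrite leqNgt; apply/negP => Ns; case/andP: p => _ /negP; apply.
  by rewrite -(mfinal_support erefl (leqnn N) v) -e mem_nth.
rewrite -scalerAr -(schur_alt C p sN) h /tiling_sign -expr_sum.
rewrite -mul_mpolyC rmorphXn rmorphN1; congr (_ * _).
by congr (\det _); apply/matrixP => i j; rewrite !mxE /beta e.
Qed.
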